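(* Consider $F^\star:=\min_{x\in\mathbb{R}^p,\,w\in\mathbb{R}^q}\{F(x,w):=f(x)+\psi(w)\ \text{ s.t. }\ Kx+Bw=b\}$, where $f:\mathbb{R}^p\to\mathbb{R}\cup\{+\infty\}$ and $\psi:\mathbb{R}^q\to\mathbb{R}\cup\{+\infty\}$ are proper, closed and convex, $K\in\mathbb{R}^{n\times p}$, $B\in\mathbb{R}^{n\times q}$, $b\in\mathbb{R}^n$. Assume the solution set is nonempty, that there exist $x\in\mathrm{ri}(\mathrm{dom}(f))$ and $w\in\mathrm{ri}(\mathrm{dom}(\psi))$ with $Kx+Bw=b$, and that $f$ is $\mu_f$-strongly convex with $\mu_f>0$ ($\psi$ is not necessarily strongly convex). Let $(x^\star,w^\star,y^\star)$ be a triple of primal-dual optimal solutions. Let $\gamma\in(\frac12,1)$, $\Gamma:=2-\frac1\gamma$, and let $\{(x^k,w^k,\bar y^k)\}$ be generated by the scheme in the context. (i) If $\rho_0\in\left(0,\frac{\Gamma\mu_f}{2\|K\|^2}\right]$, $\tau_0:=1$ and $\tau_{k+1}:=\frac{\tau_k}{2}\left(\sqrt{\tau_k^2+4}-\tau_k\right)$, then for all $k\ge1$, $$|F(x^k,w^k)-F^\star|\le\frac{2R_0^2}{(k+1)^2}\quad\text{and}\quad\|Kx^k+Bw^k-b\|\le\frac{2R_0^2}{(k+1)^2},$$ where $R_0^2:=\frac{\rho_0\|K\|^2}{\Gamma}\|x^0-x^\star\|^2+\nu_0\|w^0-w^\star\|^2+\frac{1}{\rho_0(1-\gamma)}(2\|y^\star\|+\|y^0\|+1)^2$.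 (ii) If $c>2$, $\rho_0\in\left(0,\frac{c(c-1)\Gamma\mu_f}{(2c-1)\|K\|^2}\right]$ and $\tau_k:=\frac{c}{k+c}$, then $|F(x^k,w^k)-F^\star|=O(1/k^2)$ and $\|Kx^k+Bw^k-b\|=O(1/k^2)$ still hold, and $$\liminf_{k\to\infty}\;k^2\sqrt{\log k}\,\left[|F(x^k,w^k)-F^\star|+\|Kx^k+Bw^k-b\|\right]=0.$$
   Context: $\mathrm{ri}$ is the relative interior; $\|K\|$ is the operator norm; $\mathrm{prox}_h(x):=\arg\min_y\{h(y)+\frac12\|y-x\|^2\}$. $f$ is $\mu_f$-strongly convex if $f-\frac{\mu_f}{2}\|\cdot\|^2$ is convex. $y^\star$ is a Lagrange multiplier of the constraint $Kx+Bw=b$, i.e. $(x^\star,w^\star,y^\star)$ is a saddle point of $f(x)+\psi(w)+\langle y,Kx+Bw-b\rangle$ (minimized in $(x,w)$, maximized in $y$). Scheme. Inputs: $x^0\in\mathbb{R}^p$, $w^0\in\mathbb{R}^q$, $y^0\in\mathbb{R}^n$, $\nu_0\ge0$ (a proximal weight, chosen so that the $w$-subproblem below always has an optimal solution), $\rho_0>0$, and $\{\tau_k\}$ with $\tau_0=1$ as in the claim. Set $\hat x^0:=\tilde x^0:=x^0$, $\hat w^0:=w^0$, $\tilde y^0:=\bar y^0:=y^0$. For $k\ge0$ let $\rho_k:=\frac{\rho_0}{\tau_k^2}$, $\beta_k:=\frac{\Gamma}{\rho_k\|K\|^2}$, $\eta_k:=(1-\gamma)\rho_k$, and update $$\begin{aligned}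 w^{k+1}&:=\arg\min_w\left\{\psi(w)+\langle B^\top\tilde y^k,w\rangle+\tfrac{\rho_k}{2}\|K\hat x^k+Bw-b\|^2+\tfrac{\nu_0}{2}\|w-\hat w^k\|^2\right\},\\ y^{k+1}&:=\tilde y^k+\rho_k(K\hat x^k+Bw^{k+1}-b),\\ \tilde x^{k+1}&:=\mathrm{prox}_{(\beta_k/\tau_k)f}\left(\tilde x^k-\tfrac{\beta_k}{\tau_k}K^\top y^{k+1}\right),\\ x^{k+1}&:=\mathrm{prox}_{f/(\rho_k\|K\|^2)}\left(\hat x^k-\tfrac{1}{\rho_k\|K\|^2}K^\top y^{k+1}\right),\\ \hat x^{k+1}&:=(1-\tau_{k+1})x^{k+1}+\tau_{k+1}\tilde x^{k+1},\\ \hat w^{k+1}&:=w^{k+1}+\tfrac{\tau_{k+1}(1-\tau_k)}{\tau_k}(w^{k+1}-w^k),\\ \tilde y^{k+1}&:=\tilde y^k+\eta_k\left[(Kx^{k+1}+Bw^{k+1}-b)-(1-\tau_k)(Kx^k+Bw^k-b)\right],\\ \bar y^{k+1}&:=(1-\tau_k)\bar y^k+\tau_ky^{k+1}. \end{aligned}$$ *)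

(* Defs.v *)
From HB Require Import structures.
From mathcomp Require Export all_boot all_order all_algebra.
From mathcomp Require Export all_classical all_reals all_analysis.
Export Order.TTheory GRing.Theory Num.Theory.
Export numFieldNormedType.Exports.

Set Implicit Arguments.
Unset Strict Implicit.
Unset Printing Implicit Defensive.

Global Open Scope classical_set_scope.
Global Open Scope ring_scope.

(* The library norm `|x| on 'cV[R]_m is the max norm; it is used here only
   through the topology it induces.  Every norm of the statement is [enorm]. *)
Definition dotv (R : realType) (m : nat) (u v : 'cV[R]_m) : R :=
  \sum_(i < m) u i 0 * v i 0.

Definition enorm (R : realType) (m : nat) (u : 'cV[R]_m) : R :=
  Num.sqrt (dotv u u).

Definition opnorm (R : realType) (m n : nat) (A : 'M[R]_(m, n)) : R :=
  sup [set enorm (A *m u) | u in [set u : 'cV[R]_n | enorm u <= 1]].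

(* Functions R^m -> R `|` {+oo} are maps to \bar R that avoid -oo; this part of
   the typing is carried by [proper]. *)
Definition dom (R : realType) (m : nat) (h : 'cV[R]_m -> \bar R) :
    set 'cV[R]_m :=
  [set u | (h u < +oo)%E].

Definition proper (R : realType) (m : nat) (h : 'cV[R]_m -> \bar R) : Prop :=
  (forall u, h u != -oo%E) /\ dom h !=set0.

(* With 0 * +oo = 0 in \bar R, the inequality is trivial at t = 0 and t = 1. *)
Definition econvex (R : realType) (m : nat) (h : 'cV[R]_m -> \bar R) : Prop :=
  forall (u v : 'cV[R]_m) (t : R), 0 <= t <= 1 ->
    (h (t *: u + (1 - t) *: v)%R <= t%:E * h u + (1 - t)%:E * h v)%E.

Definition proper_closed_convex (R : realType) (m : nat)
    (h : 'cV[R]_m -> \bar R) : Prop :=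
  [/\ proper h, lower_semicontinuous h & econvex h].

Definition strongly_convex (R : realType) (m : nat) (mu : R)
    (h : 'cV[R]_m -> \bar R) : Prop :=
  econvex (fun u => (h u - (mu / 2 * enorm u ^+ 2)%:E)%E).

Definition affine_hull (R : realType) (m : nat) (C : set 'cV[R]_m) :
    set 'cV[R]_m :=
  [set u | exists (N : nat) (z : 'I_N -> 'cV[R]_m) (a : 'I_N -> R),
     [/\ forall i, C (z i), \sum_(i < N) a i = 1
       & u = \sum_(i < N) a i *: z i]].

Definition relint (R : realType) (m : nat) (C : set 'cV[R]_m) :
    set 'cV[R]_m :=
  [set u | C u /\ exists2 e : R, 0 < e &
     forall v, affine_hull C v -> enorm (v - u) < e -> C v].

Definition is_argmin (R : realType) (m : nat) (h : 'cV[R]_m -> \bar R)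
    (z : 'cV[R]_m) : Prop :=
  forall u, (h z <= h u)%E.

Definition is_prox (R : realType) (m : nat) (h : 'cV[R]_m -> \bar R)
    (v z : 'cV[R]_m) : Prop :=
  is_argmin (fun u => (h u + (1 / 2 * enorm (u - v) ^+ 2)%:E)%E) z.

Definition objective (R : realType) (p q : nat)
    (f : 'cV[R]_p -> \bar R) (psi : 'cV[R]_q -> \bar R)
    (x : 'cV[R]_p) (w : 'cV[R]_q) : \bar R :=
  (f x + psi w)%E.

Definition residual (R : realType) (p q n : nat)
    (K : 'M[R]_(n, p)) (B : 'M[R]_(n, q)) (b : 'cV[R]_n)
    (x : 'cV[R]_p) (w : 'cV[R]_q) : 'cV[R]_n :=
  K *m x + B *m w - b.

Definition optimal_value (R : realType) (p q n : nat)
    (f : 'cV[R]_p -> \bar R) (psi : 'cV[R]_q -> \bar R)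
    (K : 'M[R]_(n, p)) (B : 'M[R]_(n, q)) (b : 'cV[R]_n) : \bar R :=
  ereal_inf [set v | exists (x : 'cV[R]_p) (w : 'cV[R]_q),
    K *m x + B *m w = b /\ v = objective f psi x w].

Definition is_solution (R : realType) (p q n : nat)
    (f : 'cV[R]_p -> \bar R) (psi : 'cV[R]_q -> \bar R)
    (K : 'M[R]_(n, p)) (B : 'M[R]_(n, q)) (b : 'cV[R]_n)
    (x : 'cV[R]_p) (w : 'cV[R]_q) : Prop :=
  K *m x + B *m w = b /\
  forall (x' : 'cV[R]_p) (w' : 'cV[R]_q), K *m x' + B *m w' = b ->
    (objective f psi x w <= objective f psi x' w')%E.

Definition lagrangian (R : realType) (p q n : nat)
    (f : 'cV[R]_p -> \bar R) (psi : 'cV[R]_q -> \bar R)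
    (K : 'M[R]_(n, p)) (B : 'M[R]_(n, q)) (b : 'cV[R]_n)
    (x : 'cV[R]_p) (w : 'cV[R]_q) (y : 'cV[R]_n) : \bar R :=
  (f x + psi w + (dotv y (residual K B b x w))%:E)%E.

Definition is_saddle_point (R : realType) (p q n : nat)
    (f : 'cV[R]_p -> \bar R) (psi : 'cV[R]_q -> \bar R)
    (K : 'M[R]_(n, p)) (B : 'M[R]_(n, q)) (b : 'cV[R]_n)
    (xs : 'cV[R]_p) (ws : 'cV[R]_q) (ys : 'cV[R]_n) : Prop :=
  forall (x : 'cV[R]_p) (w : 'cV[R]_q) (y : 'cV[R]_n),
    (lagrangian f psi K B b xs ws y <= lagrangian f psi K B b xs ws ys)%E /\
    (lagrangian f psi K B b xs ws ys <= lagrangian f psi K B b x w ys)%E.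

Definition Gam (R : realType) (gamma : R) : R := 2 - 1 / gamma.

Definition rho_ (R : realType) (rho0 : R) (tau : nat -> R) (k : nat) : R :=
  rho0 / tau k ^+ 2.

Definition beta_ (R : realType) (n p : nat) (K : 'M[R]_(n, p))
    (gamma rho0 : R) (tau : nat -> R) (k : nat) : R :=
  Gam gamma / (rho_ rho0 tau k * opnorm K ^+ 2).

Definition eta_ (R : realType) (gamma rho0 : R) (tau : nat -> R) (k : nat) : R :=
  (1 - gamma) * rho_ rho0 tau k.

Definition w_subproblem (R : realType) (p q n : nat)
    (psi : 'cV[R]_q -> \bar R)
    (K : 'M[R]_(n, p)) (B : 'M[R]_(n, q)) (b : 'cV[R]_n) (nu0 rho : R)
    (xh : 'cV[R]_p) (wh : 'cV[R]_q) (yt : 'cV[R]_n) (w : 'cV[R]_q) : \bar R :=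
  (psi w + (dotv (B^T *m yt) w
            + rho / 2 * enorm (residual K B b xh w) ^+ 2
            + nu0 / 2 * enorm (w - wh) ^+ 2)%:E)%E.

(* Suffixes: [h] for hat, [t] for tilde, [b] (in [yb]) for bar.  The inputs
   x^0, w^0, y^0 are the values x 0, w 0, y 0.  The w-step is a relation since
   the subproblem may have several minimizers; existence of a minimizer at
   every step is part of the sequences satisfying the scheme. *)
Record scheme (R : realType) (p q n : nat)
    (f : 'cV[R]_p -> \bar R) (psi : 'cV[R]_q -> \bar R)
    (K : 'M[R]_(n, p)) (B : 'M[R]_(n, q)) (b : 'cV[R]_n)
    (gamma nu0 rho0 : R) (tau : nat -> R)
    (x xt xh : nat -> 'cV[R]_p) (w wh : nat -> 'cV[R]_q)
    (y yt yb : nat -> 'cV[R]_n) : Prop := Scheme {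
  scheme_xh0 : xh 0%N = x 0%N;
  scheme_xt0 : xt 0%N = x 0%N;
  scheme_wh0 : wh 0%N = w 0%N;
  scheme_yt0 : yt 0%N = y 0%N;
  scheme_yb0 : yb 0%N = y 0%N;
  scheme_w : forall k,
    is_argmin (w_subproblem psi K B b nu0 (rho_ rho0 tau k)
                 (xh k) (wh k) (yt k)) (w k.+1);
  scheme_y : forall k,
    y k.+1 = yt k + rho_ rho0 tau k *: residual K B b (xh k) (w k.+1);
  scheme_xt : forall k,
    let s := beta_ K gamma rho0 tau k / tau k in
    is_prox (fun u => (s%:E * f u)%E)
      (xt k - s *: (K^T *m y k.+1)) (xt k.+1);
  scheme_x : forall k,
    let s := 1 / (rho_ rho0 tau k * opnorm K ^+ 2) in
    is_prox (fun u => (s%:E * f u)%E)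
      (xh k - s *: (K^T *m y k.+1)) (x k.+1);
  scheme_xh : forall k,
    xh k.+1 = (1 - tau k.+1) *: x k.+1 + tau k.+1 *: xt k.+1;
  scheme_wh : forall k,
    wh k.+1 = w k.+1
              + (tau k.+1 * (1 - tau k) / tau k) *: (w k.+1 - w k);
  scheme_yt : forall k,
    yt k.+1 = yt k + eta_ gamma rho0 tau k *:
                (residual K B b (x k.+1) (w k.+1)
                 - (1 - tau k) *: residual K B b (x k) (w k));
  scheme_yb : forall k,
    yb k.+1 = (1 - tau k) *: yb k + tau k *: y k.+1
}.

(* Main.v *)
Require Import Defs.
From mathcomp Require Import ring lra.

Set Implicit Arguments.
Unset Strict Implicit.
Unset Printing Implicit Defensive.

(** The scheme is a chain of (strongly) convex minimizations, and the optimality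
condition of each one bounds the new function value by a quadratic expression in
any competitor ([prox_variational], [argmin_variational]).  Test [xt k.+1]
against [xs], then [x k.+1] against [(1 - tau k) x k + tau k xt k.+1], and
[w k.+1] against [(1 - tau k) w k + tau k ws].  Every scalar product that appears
is a difference of squares; the positive squares left over are absorbed by the
negative ones exactly because [Gam gamma = 2 - 1 / gamma] ([admm_step]).

Write [r k] for the residual and, for a multiplier [v],
[G k = f (x k) + psi (w k) - F* + <v, r k>].  Division of that inequality by
[tau k ^+ 2] yields ([energy_step])

  (G k.+1 + rho_k / 2 |r k.+1|^2) / tau_k^2 + V k.+1
    <= (1 - tau_k) / tau_k^2 (G k + (1 - tau_k) rho_k / 2 |r k|^2) + V k

where [V] is a weighted sum of squared distances to [xs], [ws] and [v].  The
weight of the distance to [xs] grows like [tau_k ^- 2]; the strong convexity of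
[f] pays for this growth, and the upper bound on [rho0] makes the payment large
enough.

For the recursive [tau] one has
[(1 - tau_{k+1}) / tau_{k+1}^2 = 1 / tau_k^2], so the inequality telescopes for
every [v] ([fast_rate]).  Taking [v] along the residual with norm
[2 |ys| + 1] bounds [F - F* + (2 |ys| + 1) |r|], and the saddle inequality
[F - F* >= - |ys| |r|] separates the two terms.

For [tau k = c / (k + c)] take [v = ys], for which [G] is nonnegative.  The
energy is bounded, and since [rho_k] is itself of order [tau_k ^- 2] this gives
[G = O(tau^2)] and even [|r| = O(tau^2)].  As [c > 2], the energy moreover
decreases at step [k] by at least a multiple of [k G k + k^3 |r k|^2]
([polynomial_energy]).  If [k^2 sqrt(log k) (G k + C |r k|)] stayed away from 0,
this decrease would be at least a multiple of [1 / (k log k)], hence of the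
increment of [log log k]; the energy would become negative
([liminf_sqrt_log]). *)

(** * Euclidean geometry of column vectors *)

Section Inner.
Variables (R : realType) (m : nat).
Implicit Types (u v z : 'cV[R]_m) (a t : R).

Lemma dotvC u v : dotv u v = dotv v u.
Proof. by apply: eq_bigr => i _; rewrite mulrC. Qed.

Lemma dotvDl u v z : dotv (u + v) z = dotv u z + dotv v z.
Proof. by rewrite -big_split; apply: eq_bigr => i _; rewrite mxE mulrDl. Qed.

Lemma dotvZl a u v : dotv (a *: u) v = a * dotv u v.
Proof. by rewrite mulr_sumr; apply: eq_bigr => i _; rewrite mxE mulrA. Qed.

Lemma dotvNl u v : dotv (- u) v = - dotv u v.
Proof. by rewrite -scaleN1r dotvZl mulN1r. Qed.

Lemma dotvDr u v z : dotv z (u + v) = dotv z u + dotv z v.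
Proof. by rewrite dotvC dotvDl !(dotvC z). Qed.

Lemma dotvZr a u v : dotv v (a *: u) = a * dotv v u.
Proof. by rewrite dotvC dotvZl (dotvC v). Qed.

Lemma dotvNr u v : dotv v (- u) = - dotv v u.
Proof. by rewrite dotvC dotvNl (dotvC v). Qed.

Definition dotvE := (dotvDl, dotvDr, dotvNl, dotvNr, dotvZl, dotvZr).

Lemma dotv_ge0 u : 0 <= dotv u u.
Proof. by apply: sumr_ge0 => i _; rewrite -expr2 sqr_ge0. Qed.

Lemma dotv_eq0 u : dotv u u = 0 -> u = 0.
Proof.
move=> /eqP; rewrite psumr_eq0; last by move=> i _; rewrite -expr2 sqr_ge0.
move=> /allP h; apply/matrixP => i j; rewrite (ord1 j) mxE.
by have /= := h i (mem_index_enum i); rewrite mulf_eq0 orbb => /eqP.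
Qed.

Lemma enorm_sqr u : enorm u ^+ 2 = dotv u u.
Proof. by rewrite sqr_sqrtr // dotv_ge0. Qed.

Lemma enorm_ge0 u : 0 <= enorm u.
Proof. exact: sqrtr_ge0. Qed.

Lemma enorm_eq0 u : enorm u = 0 -> u = 0.
Proof. by move=> h; apply: dotv_eq0; rewrite -enorm_sqr h expr0n. Qed.

Lemma enormZ a u : 0 <= a -> enorm (a *: u) = a * enorm u.
Proof.
by move=> a0; rewrite /enorm dotvZl dotvZr mulrA -expr2 sqrtrM ?sqr_ge0//
  sqrtr_sqr ger0_norm.
Qed.

Lemma dotv_le u v : dotv u v <= enorm u * enorm v.
Proof.
have [/enorm_eq0 ->|u0] := eqVneq (enorm u) 0.
  by rewrite -[X in dotv X _](scale0r 0) dotvZl mul0r mulr_ge0 ?enorm_ge0.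
have [/enorm_eq0 ->|v0] := eqVneq (enorm v) 0.
  by rewrite -[X in dotv _ X](scale0r 0) dotvZr mul0r mulr_ge0 ?enorm_ge0.
have up : 0 < enorm u by rewrite lt_neqAle eq_sym u0 enorm_ge0.
have vp : 0 < enorm v by rewrite lt_neqAle eq_sym v0 enorm_ge0.
have := dotv_ge0 (enorm v *: u - enorm u *: v).
rewrite !dotvE -!enorm_sqr (dotvC v u) => h.
rewrite -subr_ge0 -(pmulr_rge0 _ up) -(pmulr_rge0 _ vp).
by lra.
Qed.

Lemma dotv_norm u v : `|dotv u v| <= enorm u * enorm v.
Proof.
rewrite ler_norml dotv_le andbT lerNl -dotvNl.
have -> : enorm u = enorm (- u) by rewrite /enorm dotvNl dotvNr opprK.
exact: dotv_le.
Qed.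

Lemma enormD u v : enorm (u + v) <= enorm u + enorm v.
Proof.
rewrite -(@ler_pXn2r _ 2) ?nnegrE ?addr_ge0 ?enorm_ge0//.
rewrite sqrrD !enorm_sqr !dotvE (dotvC v u); have := dotv_le u v; lra.
Qed.

Lemma enormN u : enorm (- u) = enorm u.
Proof. by rewrite /enorm dotvNl dotvNr opprK. Qed.

Lemma three_point u v z :
  2 * dotv (u - v) (z - u) =
  dotv (v - z) (v - z) - dotv (u - z) (u - z) - dotv (u - v) (u - v).
Proof. rewrite !dotvE (dotvC v u) (dotvC z u) (dotvC z v); ring. Qed.

Lemma dotv_conv u v t : dotv ((1 - t) *: u + t *: v) ((1 - t) *: u + t *: v) =
  (1 - t) * dotv u u + t * dotv v v - t * (1 - t) * dotv (u - v) (u - v).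
Proof. rewrite !dotvE (dotvC v u); ring. Qed.

End Inner.

Lemma dotv_trmx (R : realType) (m n : nat) (A : 'M[R]_(m, n)) u v :
  dotv (A^T *m u) v = dotv u (A *m v).
Proof.
rewrite /dotv.
under eq_bigr do rewrite mxE big_distrl/=.
rewrite exchange_big; apply: eq_bigr => i _; rewrite mxE big_distrr/=.
by apply: eq_bigr => j _; rewrite mxE; ring.
Qed.

Lemma enorm0 (R : realType) (m : nat) : enorm (0 : 'cV[R]_m) = 0.
Proof. by rewrite -(scale0r 0) enormZ// mul0r. Qed.

Section OperatorNorm.
Variables (R : realType) (m n : nat) (A : 'M[R]_(m, n)).

(** Without this bound the [sup] defining [opnorm] would be a default value. *)
Lemma image_unit_ball_bounded :
  has_ubound [set enorm (A *m v) | v in [set v : 'cV[R]_n | enorm v <= 1]].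
Proof.
exists (Num.sqrt (\sum_(i < m) enorm (row i A)^T ^+ 2)) => _ [v /= v1 <-].
apply: ler_wsqrtr; apply: ler_sum => i _; rewrite -expr2.
have -> : (A *m v) i 0 = dotv (row i A)^T v.
  by rewrite mxE; apply: eq_bigr => j _; rewrite !mxE.
rewrite -real_normK ?num_real// lerXn2r ?nnegrE ?enorm_ge0//.
apply: le_trans (dotv_norm _ _) _.
by rewrite -[leRHS]mulr1 ler_wpM2l ?enorm_ge0.
Qed.

Lemma opnorm_ge0 : 0 <= opnorm A.
Proof.
apply: (ub_le_sup image_unit_ball_bounded).
by exists 0; rewrite /= ?mulmx0 enorm0.
Qed.

Lemma opnorm_le u : enorm (A *m u) <= opnorm A * enorm u.
Proof.
have [/enorm_eq0 ->|u0] := eqVneq (enorm u) 0.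
  by rewrite mulmx0 !enorm0 mulr0.
have up : 0 < enorm u by rewrite lt_neqAle eq_sym u0 enorm_ge0.
have vp : 0 <= (enorm u)^-1 by rewrite invr_ge0 ltW.
rewrite -ler_pdivrMr// mulrC -enormZ// scalemxAr.
apply: (ub_le_sup image_unit_ball_bounded).
by exists ((enorm u)^-1 *: u); rewrite //= enormZ// mulVf.
Qed.

End OperatorNorm.

(** Turns a bound on the Lagrangian valid for all multipliers into a bound on the
exact penalty [c * enorm r].  For [r = 0] the convention [x / 0 = 0] makes the
witness the zero vector. *)
Lemma exists_aligned (R : realType) (n : nat) (r : 'cV[R]_n) (c : R) : 0 <= c ->
  exists2 v, dotv v r = c * enorm r & enorm v <= c.
Proof.
move=> c0; exists ((c / enorm r) *: r).
  rewrite dotvZl -enorm_sqr; have [->|r0] := eqVneq (enorm r) 0.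
    by rewrite expr0n /= !mulr0.
  by field.
rewrite enormZ ?divr_ge0 ?enorm_ge0//.
by have [->|r0] := eqVneq (enorm r) 0; [rewrite mulr0|rewrite divfK].
Qed.

(** * Optimality conditions for strongly convex minimization *)

Lemma ge0_of_small (R : realType) (a c : R) :
  (forall t, 0 < t <= 1 -> 0 <= a + t * c) -> 0 <= a.
Proof.
move=> h; rewrite leNgt; apply/negP => a0.
have d0 : 0 < `|c| - a by have := normr_ge0 c; lra.
(* a step so small that [`|t * c| <= `|a| / 2] *)
have := h (- a / (2 * (`|c| - a))).
have -> : 0 < - a / (2 * (`|c| - a)) <= 1.
  rewrite divr_gt0 ?mulr_gt0 ?oppr_gt0//= ler_pdivrMr ?mulr_gt0//.
  by have := normr_ge0 c; lra.
move=> /(_ isT).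
have -> : a + - a / (2 * (`|c| - a)) * c = a * (2 * (`|c| - a) - c) / (2 * (`|c| - a)).
  by field; rewrite gt_eqF.
rewrite pmulr_lge0 ?invr_gt0 ?mulr_gt0// nmulr_rge0//.
by have := ler_norm c; lra.
Qed.

Section Convex.
Variables (R : realType) (m : nat).
Implicit Types (h : 'cV[R]_m -> \bar R) (u v z : 'cV[R]_m).

Lemma domE h u : proper h -> dom h u -> h u = (fine (h u))%:E.
Proof. by move=> [hN _] hu; rewrite fineK// fin_real// ltNye hN; exact: hu. Qed.

Lemma econvex_strongly0 h : econvex h -> strongly_convex 0 h.
Proof.
have e u : (h u - (0 / 2 * enorm u ^+ 2)%:E)%E = h u by rewrite !mul0r sube0.
by move=> hc u v t t01; rewrite !e; exact: hc.
Qed.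

Lemma strongly_convex_fine h mu u v (t : R) : proper h -> strongly_convex mu h ->
  dom h u -> dom h v -> 0 <= t <= 1 ->
  dom h (t *: u + (1 - t) *: v) /\
  fine (h (t *: u + (1 - t) *: v)) <= t * fine (h u) + (1 - t) * fine (h v)
     - mu / 2 * (t * (1 - t) * dotv (u - v) (u - v)).
Proof.
move=> hp hs du dv t01; have := hs u v t t01.
rewrite (domE hp du) (domE hp dv) !enorm_sqr/=.
set z := t *: u + _; rewrite -!EFinB -!EFinM -EFinD => hz.
have dz : dom h z.
  by rewrite /dom/= -(sube0 (h z)); move: hz; case: (h z) => //= r; rewrite ltry.
split=> //; move: hz; rewrite (domE hp dz)/= -EFinB lee_fin.
rewrite (_ : z = (1 - (1 - t)) *: u + (1 - t) *: v); last first.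
  by rewrite subKr.
rewrite dotv_conv; lra.
Qed.

(** First-order condition: minimality is tested on the segment from [z] to [u],
where the perturbation [g] is a quadratic polynomial of slope [a] at [z].  Only
the slope survives as the point tends to [z], and the strong convexity of [h]
contributes the term in [mu]. *)
Lemma argmin_variational h (g : 'cV[R]_m -> R) mu z : proper h -> strongly_convex mu h ->
  is_argmin (fun u => (h u + (g u)%:E)%E) z ->
  dom h z /\ forall u, dom h u -> forall a c : R,
    (forall t, g (t *: u + (1 - t) *: z) = g z + t * a + t ^+ 2 * c) ->
    fine (h z) + mu / 2 * dotv (u - z) (u - z) <= fine (h u) + a.
Proof.
move=> hp hs hz.
have dz : dom h z.
  have [_ [u0 du0]] := hp; have := hz u0.
  rewrite (domE hp du0) /dom/=; case: (h z) => //= r _; exact: ltry.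
split=> // u du a c gE.
rewrite -subr_ge0.
apply: (@ge0_of_small _ _ (c + mu / 2 * dotv (u - z) (u - z))) => t /andP[t0 t1].
have t01 : 0 <= t <= 1 by rewrite ltW.
have [dt ht] := strongly_convex_fine hp hs du dz t01.
have := hz (t *: u + (1 - t) *: z).
rewrite (domE hp dz) (domE hp dt) -!EFinD lee_fin gE => h1.
rewrite -(pmulr_rge0 _ t0).
by lra.
Qed.

Lemma prox_variational h mu (s : R) v z : proper h -> strongly_convex mu h -> 0 < s ->
  is_prox (fun u => (s%:E * h u)%E) v z ->
  dom h z /\ forall u, dom h u ->
    fine (h z) + mu / 2 * dotv (u - z) (u - z) <= fine (h u) + s^-1 * dotv (z - v) (u - z).
Proof.
move=> hp hs s0 hz.
have hz' : is_argmin (fun u => (h u + (s^-1 * (1 / 2 * enorm (u - v) ^+ 2))%:E)%E) z.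
  move=> u; have := hz u.
  have e w : (h w + (s^-1 * (1 / 2 * enorm (w - v) ^+ 2))%:E =
    s^-1%:E * (s%:E * h w + (1 / 2 * enorm (w - v) ^+ 2)%:E))%E.
    by rewrite muleDr ?fin_num_adde_defl// muleA -!EFinM mulVf ?gt_eqF// mul1e.
  by rewrite !e lee_pmul2l// ?lte_fin ?invr_gt0.
have [dz H] := argmin_variational hp hs hz'.
split=> // u du.
apply: (H u du _ (s^-1 * (1 / 2 * dotv (u - z) (u - z)))) => t.
rewrite !enorm_sqr (_ : _ + _ - v = (z - v) + t *: (u - z)); last first.
  by apply/matrixP => i j; rewrite !mxE; ring.
move: (z - v) (u - z) => d e.
rewrite !dotvE (dotvC e d).
by field; rewrite gt_eqF.
Qed.

End Convex.

(** * One step of the scheme *)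

(** At [t = 1] the point [x] has weight 0 and may lie outside the domain of [h];
this is how a starting point outside the domains enters. *)
Lemma extrapolation_le (R : realType) (m : nat) (h : 'cV[R]_m -> \bar R) mu
    (t : R) x z :
  proper h -> 0 <= mu -> strongly_convex mu h -> 0 < t <= 1 ->
  t = 1 \/ dom h x -> dom h z ->
  dom h ((1 - t) *: x + t *: z) /\
  fine (h ((1 - t) *: x + t *: z)) <= (1 - t) * fine (h x) + t * fine (h z).
Proof.
move=> hp mu0 hs /andP[t0 t1] [->|dx] dz.
  by rewrite subrr scale0r add0r scale1r mul0r add0r mul1r.
have [|dz' hb] := strongly_convex_fine hp hs dx dz (t := 1 - t).
  by apply/andP; split; lra.
rewrite !subKr in dz' hb; split=> //; apply: le_trans hb _.
have : 0 <= mu / 2 * ((1 - t) * t * dotv (x - z) (x - z)).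
  by rewrite !mulr_ge0 ?dotv_ge0 ?invr_ge0//; lra.
lra.
Qed.

(** Two proximal steps are combined.  The point [c = (1 - t) x + t xt'] is the
competitor of [x'] and [xs] the competitor of [xt'], so that convexity of [f]
eliminates [f c].  The three-point identity leaves negative squares of [x' - c]
and of [xt' - xt]; since [x' - xh = (x' - c) + t (xt' - xt)], they dominate a
multiple of the square of [x' - xh], kept on the left for the dual step. *)
Lemma primal_x_step (R : realType) (m : nat) (f : 'cV[R]_m -> \bar R)
    (mu rho L2 G t : R) (x xt xh x' xt' xs g : 'cV[R]_m) :
  proper f -> 0 <= mu -> strongly_convex mu f ->
  0 < rho -> 0 < L2 -> 0 < G < 1 -> 0 < t <= 1 ->
  dom f xs -> t = 1 \/ dom f x ->
  xh = (1 - t) *: x + t *: xt ->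
  let s := 1 / (rho * L2) in
  is_prox (fun u => (s%:E * f u)%E) (xh - s *: g) x' ->
  let s' := G / (rho * L2) / t in
  is_prox (fun u => (s'%:E * f u)%E) (xt - s' *: g) xt' ->
  [/\ dom f x', dom f xt' &
  fine (f x') + (rho * t ^+ 2 * L2 / G / 2 + mu * t / 2) * dotv (xt' - xs) (xt' - xs)
    + rho * L2 / 2 * (2 - G) * dotv (x' - xh) (x' - xh)
  <= (1 - t) * fine (f x) + t * fine (f xs) + dotv g ((1 - t) *: x + t *: xs - x')
    + rho * t ^+ 2 * L2 / G / 2 * dotv (xt - xs) (xt - xs)].
Proof.
move=> fp mu0 fs rho0 L0 /andP[G0 G1] t01 dxs dx xhE s px s' pxt.
have /andP[t0 t1] := t01.
have rL : 0 < rho * L2 by rewrite mulr_gt0.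
have [dx' Hx] := prox_variational fp fs (divr_gt0 ltr01 rL) px.
have [dxt' Hxt] := prox_variational fp fs (divr_gt0 (divr_gt0 G0 rL) t0) pxt.
split=> //.
have [dc fc] := extrapolation_le fp mu0 fs t01 dx dxt'.
move: Hx => /(_ _ dc); move: Hxt => /(_ _ dxs); move: fc.
set c := (1 - t) *: x + t *: xt'.
have -> : x' - (xh - s *: g) = (x' - xh) + s *: g by rewrite opprB addrA addrAC.
have -> : xt' - (xt - s' *: g) = (xt' - xt) + s' *: g by rewrite opprB addrA addrAC.
have split_grad r (e d : 'cV[R]_m) : 0 < r ->
    r^-1 * dotv (e + r *: g) d = r^-1 * dotv e d + dotv g d.
  by move=> r0; rewrite dotvDl dotvZl mulrDr mulrA mulVf ?mul1r ?gt_eqF.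
rewrite !split_grad ?divr_gt0//.
move=> fc Hxt Hx.
have mc : 0 <= mu / 2 * dotv (c - x') (c - x') by rewrite mulr_ge0 ?dotv_ge0 ?divr_ge0.
have gE : dotv g ((1 - t) *: x + t *: xs - x') = dotv g (c - x') + t * dotv g (xs - xt').
  by rewrite /c !dotvE; ring.
have tp1 := three_point x' xh c.
have tp2 := three_point xt' xt xs.
have xhc : xh - c = t *: (xt - xt').
  by rewrite xhE /c scalerBr opprD addrACA subrr add0r.
rewrite xhc !(dotvZl t) !(dotvZr t) in tp1.
have dsym : dotv (xt' - xt) (xt' - xt) = dotv (xt - xt') (xt - xt').
  by rewrite -opprB dotvNl dotvNr opprK.
have split_le : G * (1 - G) * dotv (x' - xh) (x' - xh) <=
    G * dotv (x' - c) (x' - c) + (1 - G) * t ^+ 2 * dotv (xt - xt') (xt - xt').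
  have -> : x' - xh = (x' - c) - t *: (xt - xt') by rewrite -xhc opprB addrA subrK.
  have := dotv_ge0 (G *: (x' - c) + ((1 - G) * t) *: (xt - xt')).
  move: (x' - c) (xt - xt') => e d; rewrite !dotvE (dotvC e d); lra.
have sE : s^-1 = rho * L2 by rewrite /s div1r invrK.
have s'E : s'^-1 = rho * L2 * t / G by rewrite /s'; field; rewrite !gt_eqF.
rewrite gE; rewrite sE in Hx; rewrite s'E in Hxt.
rewrite dsym in tp2.
move: Hx Hxt tp1 tp2 split_le.
have -> : rho * t ^+ 2 * L2 / G = t * (rho * L2 * t / G) by ring.
set a := rho * L2 * t / G.
have aG : rho * L2 * t = a * G by rewrite /a mulfVK ?gt_eqF.
have symxs : dotv (xs - xt') (xs - xt') = dotv (xt' - xs) (xt' - xs).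
  by rewrite -opprB dotvNl dotvNr opprK.
rewrite symxs.
move: (dotv (x' - c) (x' - c)) (dotv (xt - xt') (xt - xt')) => E D.
move: (dotv (x' - xh) (x' - xh)) (dotv (x' - xh) (c - x')) => N P.
move: (dotv (xt' - xs) (xt' - xs)) (dotv (xt - xs) (xt - xs)) => S1 S0.
move: (dotv (xt' - xt) (xs - xt')) => Q Hx Hxt tp1 tp2 hq.
have hq' : rho * L2 * (1 - G) * N <= rho * L2 * E + (t * a - rho * L2 * t ^+ 2) * D.
  rewrite -(ler_pM2l G0).
  have -> : G * (rho * L2 * (1 - G) * N) = rho * L2 * (G * (1 - G) * N) by ring.
  have -> : G * (rho * L2 * E + (t * a - rho * L2 * t ^+ 2) * D) =
    rho * L2 * (G * E) + (t * (a * G) - G * rho * L2 * t ^+ 2) * D by ring.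
  rewrite -aG; have := ler_wpM2l (ltW rL) hq; lra.
have Hxt' := ler_wpM2l (ltW t0) Hxt.
have P' : rho * L2 * P = rho * L2 * ((t * (t * D) - N - E) / 2).
  by congr (_ * _); lra.
have Q' : t * (a * Q) = t * (a * ((S0 - S1 - D) / 2)).
  by congr (_ * (_ * _)); lra.
rewrite P' in Hx; rewrite !mulrDr Q' in Hxt'; lra.
Qed.

(** The gradient of the augmented Lagrangian part at [w'] is [B^T y'], by the very
choice of [y']; what remains of the objective is a proximal term, treated by the
three-point identity along [wt' - wt]. *)
Lemma primal_w_step (R : realType) (p q n : nat) (psi : 'cV[R]_q -> \bar R)
    (K : 'M[R]_(n, p)) (B : 'M[R]_(n, q)) (b : 'cV[R]_n)
    (nu rho t : R) (xh : 'cV[R]_p) (w wt wh w' wt' ws : 'cV[R]_q)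
    (yt y' : 'cV[R]_n) :
  proper psi -> econvex psi -> 0 <= nu -> 0 < t <= 1 ->
  dom psi ws -> t = 1 \/ dom psi w ->
  wh = (1 - t) *: w + t *: wt -> w' = (1 - t) *: w + t *: wt' ->
  is_argmin (w_subproblem psi K B b nu rho xh wh yt) w' ->
  y' = yt + rho *: residual K B b xh w' ->
  dom psi w' /\
  fine (psi w') + nu * t ^+ 2 / 2 * dotv (wt' - ws) (wt' - ws)
  <= (1 - t) * fine (psi w) + t * fine (psi ws)
    + dotv y' (B *m ((1 - t) *: w + t *: ws - w'))
    + nu * t ^+ 2 / 2 * dotv (wt - ws) (wt - ws).
Proof.
move=> pp pc nu0 t01 dws dw whE w'E hw y'E.
have ps := econvex_strongly0 pc.
have [dw' H] := argmin_variational pp ps hw.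
split=> //.
have [dc fc] := extrapolation_le pp (lexx 0) ps t01 dw dws.
set u := (1 - t) *: w + t *: ws in dc fc *.
have wwh : w' - wh = t *: (wt' - wt).
  by rewrite w'E whE scalerBr opprD addrACA subrr add0r.
have uw : u - w' = t *: (ws - wt').
  by rewrite w'E /u scalerBr opprD addrACA subrr add0r.
have {}H : fine (psi w') <= fine (psi u) +
    (dotv y' (B *m (u - w')) + nu * dotv (w' - wh) (u - w')).
  have := H u dc (dotv y' (B *m (u - w')) + nu * dotv (w' - wh) (u - w'))
    (rho / 2 * dotv (B *m (u - w')) (B *m (u - w')) + nu / 2 * dotv (u - w') (u - w')).
  rewrite !mul0r addr0; apply => r.
  have -> : r *: u + (1 - r) *: w' = w' + r *: (u - w').
    by apply/matrixP => i j; rewrite !mxE; ring.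
  have -> : residual K B b xh (w' + r *: (u - w')) =
      residual K B b xh w' + r *: (B *m (u - w')).
    rewrite /residual mulmxDr -scalemxAr.
    by apply/matrixP => i j; rewrite !mxE; ring.
  have -> : w' + r *: (u - w') - wh = (w' - wh) + r *: (u - w') by rewrite addrAC.
  rewrite !dotv_trmx (mulmxDr B w') -scalemxAr !enorm_sqr y'E.
  move: (residual _ _ _ _ _) (B *m w') (w' - wh) (u - w') => r0 Bw e d.
  move: (B *m d) => Bd.
  by rewrite !dotvE (dotvC Bd r0) (dotvC d e); field.
have tp := three_point wt' wt ws.
have dE : dotv (w' - wh) (u - w') = t ^+ 2 * ((dotv (wt - ws) (wt - ws) -
    dotv (wt' - ws) (wt' - ws) - dotv (wt' - wt) (wt' - wt)) / 2).
  rewrite wwh uw dotvZl dotvZr mulrA -expr2; congr (_ * _); lra.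
have : 0 <= nu * (t ^+ 2 * dotv (wt' - wt) (wt' - wt)).
  exact: (mulr_ge0 nu0 (mulr_ge0 (sqr_ge0 t) (dotv_ge0 _))).
rewrite dE in H; lra.
Qed.

(** Here [e = K (x' - xh)] is the error made by evaluating the residual at [xh]
instead of [x'], and [s] is the previous residual scaled by [1 - t].  The
difference of the two sides is [rho / (2 gamma)] times the square of
[gamma (r' - s) - e]. *)
Lemma dual_step (R : realType) (n : nat) (rho gamma : R)
    (y yt yt' y' r' s e : 'cV[R]_n) :
  0 < rho -> 0 < gamma < 1 ->
  y' = yt + rho *: (r' - e) ->
  yt' = yt + ((1 - gamma) * rho) *: (r' - s) ->
  dotv (y - y') (r' - s) + rho / 2 * dotv r' r'
    + 1 / (2 * ((1 - gamma) * rho)) * dotv (yt' - y) (yt' - y)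
  <= rho / 2 * dotv s s + 1 / (2 * ((1 - gamma) * rho)) * dotv (yt - y) (yt - y)
    + rho / (2 * gamma) * dotv e e.
Proof.
move=> rho0 /andP[g0 g1] -> ->.
have -> : s = r' - (r' - s) by rewrite subKr.
rewrite (_ : r' - (r' - (r' - s)) = r' - s); last by rewrite subKr.
rewrite (_ : yt + _ - y = (yt - y) + ((1 - gamma) * rho) *: (r' - s)); last by rewrite addrAC.
rewrite (_ : y - _ = - (yt - y) - rho *: (r' - e)); last by rewrite opprB opprD addrA.
move: (r' - s) (yt - y) => v z.
have h : 0 <= rho / (2 * gamma) * dotv (gamma *: v - e) (gamma *: v - e).
  by rewrite mulr_ge0 ?dotv_ge0// divr_ge0 ?mulr_ge0 ?ltW.
rewrite -subr_ge0; apply: le_trans h _; rewrite le_eqVlt; apply/orP; left; apply/eqP.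
rewrite !dotvE (dotvC v z) (dotvC e v) (dotvC v r').
by field; rewrite !gt_eqF// ?subr_gt0//.
Qed.

(** Sum of the three partial steps.  The error term [rho / (2 gamma) |e|^2] of the
dual step is at most [rho |K|^2 / (2 gamma) |x' - xh|^2], which is exactly the
square kept by [primal_x_step], because [2 - Gam gamma = 1 / gamma]. *)
Lemma admm_step (R : realType) (p q n : nat)
    (f : 'cV[R]_p -> \bar R) (psi : 'cV[R]_q -> \bar R)
    (K : 'M[R]_(n, p)) (B : 'M[R]_(n, q)) (b : 'cV[R]_n)
    (mu nu rho gamma t : R)
    (x xt xh x' xt' xs : 'cV[R]_p) (w wt wh w' wt' ws : 'cV[R]_q)
    (y yt yt' y' : 'cV[R]_n) :
  proper f -> 0 <= mu -> strongly_convex mu f -> proper psi -> econvex psi ->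
  0 <= nu -> 0 < rho -> 0 < opnorm K -> 1 / 2 < gamma < 1 -> 0 < t <= 1 ->
  dom f xs -> dom psi ws -> K *m xs + B *m ws = b ->
  t = 1 \/ dom f x /\ dom psi w ->
  xh = (1 - t) *: x + t *: xt ->
  wh = (1 - t) *: w + t *: wt -> w' = (1 - t) *: w + t *: wt' ->
  is_argmin (w_subproblem psi K B b nu rho xh wh yt) w' ->
  y' = yt + rho *: residual K B b xh w' ->
  let s := Gam gamma / (rho * opnorm K ^+ 2) / t in
  is_prox (fun u => (s%:E * f u)%E) (xt - s *: (K^T *m y')) xt' ->
  let s := 1 / (rho * opnorm K ^+ 2) in
  is_prox (fun u => (s%:E * f u)%E) (xh - s *: (K^T *m y')) x' ->
  yt' = yt + ((1 - gamma) * rho) *: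
    (residual K B b x' w' - (1 - t) *: residual K B b x w) ->
  let D x w := fine (f x) + fine (psi w) - (fine (f xs) + fine (psi ws))
    + dotv y (residual K B b x w) in
  [/\ dom f x', dom psi w' &
    D x' w' + rho / 2 * dotv (residual K B b x' w') (residual K B b x' w')
    + (rho * t ^+ 2 * opnorm K ^+ 2 / Gam gamma / 2 + mu * t / 2)
        * dotv (xt' - xs) (xt' - xs)
    + nu * t ^+ 2 / 2 * dotv (wt' - ws) (wt' - ws)
    + 1 / (2 * ((1 - gamma) * rho)) * dotv (yt' - y) (yt' - y)
  <= (1 - t) * D x w
    + rho / 2 * (1 - t) ^+ 2 * dotv (residual K B b x w) (residual K B b x w)
    + rho * t ^+ 2 * opnorm K ^+ 2 / Gam gamma / 2 * dotv (xt - xs) (xt - xs)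
    + nu * t ^+ 2 / 2 * dotv (wt - ws) (wt - ws)
    + 1 / (2 * ((1 - gamma) * rho)) * dotv (yt - y) (yt - y)].
Proof.
move=> fp mu0 fs pp pc nu0 rho0 K0 /andP[g0 g1] t01 dxs dws feas dxw xhE whE w'E
  hw y'E s' hxt s hx yt'E D.
have gpos : 0 < gamma by lra.
have G01 : 0 < Gam gamma < 1.
  rewrite /Gam subr_gt0 ltr_pdivrMr// ltrBlDr -ltrBlDl ltr_pdivlMr//.
  by apply/andP; split; lra.
have dx : t = 1 \/ dom f x by case: dxw => [|[]]; [left|right].
have dw : t = 1 \/ dom psi w by case: dxw => [|[]]; [left|right].
have [dx' dxt' Hx] := primal_x_step fp mu0 fs rho0 (exprn_gt0 2 K0) G01 t01 dxs dx xhE hx hxt.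
have [dw' Hw] := primal_w_step pp pc nu0 t01 dws dw whE w'E hw y'E.
split=> //.
set e := K *m (x' - xh).
have eE : residual K B b xh w' = residual K B b x' w' - e.
  by rewrite /e /residual mulmxBr; apply/matrixP => i j; rewrite !mxE; ring.
rewrite eE in y'E.
have gp : 0 < gamma < 1 by rewrite gpos.
have Hy := dual_step y rho0 gp y'E yt'E.
have He : dotv e e <= opnorm K ^+ 2 * dotv (x' - xh) (x' - xh).
  rewrite -!enorm_sqr -exprMn lerXn2r ?nnegrE ?mulr_ge0 ?enorm_ge0 ?opnorm_le//.
  exact: ltW.
have {}He : rho / (2 * gamma) * dotv e e <=
    rho * opnorm K ^+ 2 / 2 * (2 - Gam gamma) * dotv (x' - xh) (x' - xh).
  have -> : 2 - Gam gamma = gamma^-1 by rewrite /Gam div1r subKr.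
  have c0 : 0 <= rho / (2 * gamma) by rewrite divr_ge0 ?mulr_ge0 ?ltW.
  apply: le_trans (ler_wpM2l c0 He) _; rewrite le_eqVlt; apply/orP; left; apply/eqP.
  by field; rewrite gt_eqF.
have Hg : dotv (K^T *m y') ((1 - t) *: x + t *: xs - x') +
    dotv y' (B *m ((1 - t) *: w + t *: ws - w')) =
    dotv y' ((1 - t) *: residual K B b x w - residual K B b x' w').
  rewrite dotv_trmx -dotvDr; congr (dotv _ _).
  rewrite /residual -[in RHS]feas !mulmxDr !mulmxN -!scalemxAr.
  by apply/matrixP => i j; rewrite !mxE; ring.
move: Hx Hw Hy He Hg; rewrite /D.
move: (residual K B b x' w') (residual K B b x w) => r' r.
rewrite !dotvE.
lra.
Qed.

(** * Lower limits and the divergence of sum 1 / (k log k) *)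

Lemma limn_einf_eq0 (R : realType) (u : nat -> \bar R) :
  (forall k, (0 <= u k)%E) ->
  (forall e : R, 0 < e -> forall N, exists2 k, (N <= k)%N & (u k <= e%:E)%E) ->
  limn_einf u = 0%E.
Proof.
move=> u0 small.
have e : einfs u = cst 0%E.
  apply/funext => N /=.
  apply/eqP; rewrite eq_le; apply/andP; split.
    apply/lee_addgt0Pr => e e0; rewrite add0e; have [k Nk uk] := small e e0 N.
    by apply: ge_ereal_inf; exists (u k) => //; exists k.
  by apply: le_ereal_inf_tmp => _ [k _ <-].
by rewrite limn_einf_lim e; exact: lim_cst.
Qed.

(** The discrete derivative of [ln (ln k)]: [ln (1 + z) <= z] is applied twice. *)
Lemma lnln_increment (R : realType) (k : R) : 1 < k ->
  ln (ln (k + 1)) - ln (ln k) <= (k * ln k)^-1.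
Proof.
move=> k1; have k0 : 0 < k by lra.
have l0 := ln_gt0 k1.
have le1 (a d : R) : 0 < a -> 0 < d -> ln (a + d) <= ln a + d / a.
  move=> a0 d0; have -> : a + d = a * (1 + d / a) by field; rewrite gt_eqF.
  have da : 0 < d / a by rewrite divr_gt0.
  by rewrite lnM ?posrE ?addr_gt0// lerD2l le_ln1Dx//; lra.
rewrite lerBlDl; apply: le_trans (_ : _ <= ln (ln k + k^-1)) _.
  have := le1 k 1 k0 ltr01; rewrite div1r => h.
  by rewrite ler_ln// posrE ?addr_gt0 ?invr_gt0 ?ln_gt0//; lra.
by have := le1 _ _ l0 (_ : 0 < k^-1); rewrite invr_gt0 invfM => /(_ k0).
Qed.

(** Suppose the quantity exceeds [e] from [n0] on.  One of the two summands then
exceeds [e / 2]; with [sqrt (ln k) <= ln k] in the first case, and after squaring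
in the second, the decrease of [W] at [k] is at least [delta * kap / (k ln k)].
So [W k + delta * kap * ln (ln k)] is nonincreasing although [ln (ln k)] tends
to infinity, which contradicts [0 <= W]. *)
Lemma liminf_sqrt_log (R : realType) (D N W : nat -> R) (delta C e : R) (n0 : nat) :
  0 < delta -> 0 <= C -> 0 < e ->
  (forall k, (1 <= k)%N -> 0 <= D k) -> (forall k, 0 <= N k) -> (forall k, 0 <= W k) ->
  (forall k, (1 <= k)%N ->
     W k.+1 + delta * (k%:R * D k + k%:R ^+ 3 * N k ^+ 2) <= W k) ->
  exists2 k, (n0 <= k)%N &
    k%:R ^+ 2 * Num.sqrt (ln k%:R) * (D k + C * N k) <= e.
Proof.
move=> d0 C0 e0 D0 N0 W0 step; apply: contrapT => H.
have {}H k : (n0 <= k)%N -> e < k%:R ^+ 2 * Num.sqrt (ln k%:R) * (D k + C * N k).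
  by move=> nk; rewrite ltNge; apply/negP => h; apply: H; exists k.
pose kap := Num.min (e / 2) (e ^+ 2 / 4 / (C + 1) ^+ 2).
have C1 : 0 < (C + 1) ^+ 2 by rewrite exprn_gt0//; lra.
have kap0 : 0 < kap by rewrite lt_min !divr_gt0// exprn_gt0.
(* from [n1] on, [1 <= ln k] *)
pose n1 := maxn n0 (Num.truncn (expR (1 : R))).+1.
have n1P k : (n1 <= k)%N -> [/\ (n0 <= k)%N, expR 1 <= k%:R :> R & 1 < k%:R :> R].
  rewrite /n1 geq_max => /andP[-> h].
  have h' : expR 1 < k%:R :> R.
    by apply: lt_le_trans (truncnS_gt _) _; rewrite ler_nat.
  have := expR_ge1Dx (1 : R); split=> //; [exact: ltW|lra].
have low k : (n1 <= k)%N ->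
    kap * (ln (ln k.+1%:R) - ln (ln k%:R)) <= k%:R * D k + k%:R ^+ 3 * N k ^+ 2.
  move=> nk; have [n0k ek k1] := n1P k nk.
  have k0 : (0 : R) < k%:R by lra.
  have l1 : 1 <= ln (k%:R : R).
    by rewrite -[leLHS](expRK (1 : R)) ler_ln ?posrE ?expR_gt0.
  have kl0 : 0 < k%:R * ln (k%:R : R) by rewrite mulr_gt0//; lra.
  apply: le_trans (_ : _ <= kap * (k%:R * ln k%:R)^-1) _.
    by rewrite ler_wpM2l ?(ltW kap0)// -natr1 lnln_increment.
  rewrite ler_pdivrMr//.
  have k1n : (1 <= k)%N by rewrite -(ltr_nat R); lra.
  have := H k n0k; set l := ln _ in l1 kl0 *; set s := Num.sqrt l.
  have s2 : s ^+ 2 = l by rewrite sqr_sqrtr//; lra.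
  have s0 : 0 <= s by rewrite sqrtr_ge0.
  have s1 : 1 <= s by rewrite -(sqrtr1 R) ler_wsqrtr.
  have sl : s <= l by rewrite -s2 expr2 ler_peMr.
  have k2 : 0 < (k%:R : R) ^+ 2 by rewrite exprn_gt0.
  have DD := D0 k k1n; have NN := N0 k.
  rewrite mulrDr => Hk.
  have [big|small] := leP (e / 2) (k%:R ^+ 2 * s * D k).
    apply: le_trans (_ : _ <= e / 2) _; first by rewrite ge_min lexx.
    apply: le_trans big _.
    have -> : (k%:R * D k + k%:R ^+ 3 * N k ^+ 2) * (k%:R * l) =
      k%:R ^+ 2 * l * D k + (k%:R ^+ 2) ^+ 2 * l * N k ^+ 2 by ring.
    apply: ler_wpDr; first by rewrite !mulr_ge0 ?sqr_ge0//; lra.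
    by rewrite ler_wpM2r// ler_wpM2l// ltW.
  have {}Hk : e / 2 <= k%:R ^+ 2 * s * (C * N k) by lra.
  have Hk2 : (e / 2) ^+ 2 <= (k%:R ^+ 2 * s * (C * N k)) ^+ 2.
    by rewrite lerXn2r// nnegrE; lra.
  have X0 : 0 <= (k%:R ^+ 2) ^+ 2 * l * N k ^+ 2.
    by rewrite mulr_ge0 ?mulr_ge0 ?sqr_ge0//; lra.
  apply: le_trans (_ : _ <= (k%:R ^+ 2) ^+ 2 * l * N k ^+ 2) _; last first.
    have -> : (k%:R * D k + k%:R ^+ 3 * N k ^+ 2) * (k%:R * l) =
      k%:R ^+ 2 * l * D k + (k%:R ^+ 2) ^+ 2 * l * N k ^+ 2 by ring.
    by apply: ler_wpDl => //; rewrite !mulr_ge0//; lra.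
  apply: le_trans (_ : _ <= e ^+ 2 / 4 / (C + 1) ^+ 2) _.
    by rewrite ge_min lexx orbT.
  rewrite ler_pdivrMr//; apply: le_trans (_ : _ <= (k%:R ^+ 2) ^+ 2 * l * N k ^+ 2 * C ^+ 2) _.
    rewrite -s2; have -> : (k%:R ^+ 2) ^+ 2 * s ^+ 2 * N k ^+ 2 * C ^+ 2 =
      (k%:R ^+ 2 * s * (C * N k)) ^+ 2 by ring.
    apply: le_trans Hk2; rewrite le_eqVlt; apply/orP; left; apply/eqP; by field.
  by rewrite ler_wpM2l// lerXn2r ?nnegrE//; lra.
have dk0 : 0 < delta * kap by rewrite mulr_gt0.
have tele j : W (n1 + j)%N + delta * kap * ln (ln (n1 + j)%:R)
    <= W n1 + delta * kap * ln (ln n1%:R).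
  elim: j => [|j IH]; first by rewrite addn0.
  apply: le_trans IH; rewrite addnS.
  have n1j : (1 <= n1 + j)%N by rewrite addn_gt0 /n1 leq_max orbT.
  have := step _ n1j; have := ler_wpM2l (ltW d0) (low _ (leq_addr j n1)).
  lra.
pose M := (W n1 + delta * kap * ln (ln n1%:R)) / (delta * kap).
pose j := (Num.truncn (expR (expR (M + 1)))).+1.
have jM : expR (expR (M + 1)) < (n1 + j)%:R.
  by apply: lt_le_trans (truncnS_gt _) _; rewrite ler_nat leq_addl.
have h1 : expR (M + 1) < ln (n1 + j)%:R.
  by rewrite -[ltLHS]expRK ltr_ln ?posrE ?expR_gt0// (lt_trans _ jM) ?expR_gt0.
have h2 : M + 1 < ln (ln (n1 + j)%:R).
  by rewrite -[ltLHS]expRK ltr_ln ?posrE ?expR_gt0// (lt_trans _ h1) ?expR_gt0.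
have := tele j; have := W0 (n1 + j)%N.
have -> : W n1 + delta * kap * ln (ln n1%:R) = delta * kap * M.
  by rewrite /M [RHS]mulrC divfK ?gt_eqF.
have : delta * kap * M < delta * kap * ln (ln (n1 + j)%:R).
  by rewrite ltr_pM2l//; lra.
lra.
Qed.

(** * The two choices of tau *)

(** [s] is the positive root of [s^2 = t^2 (1 - s)], hence
[(1 / s - 1 / 2)^2 = 1 / t^2 + 1 / 4], which gives the last claim. *)
Lemma tau_recurrence (R : realType) (t : R) : 0 < t <= 1 ->
  let s := t / 2 * (Num.sqrt (t ^+ 2 + 4) - t) in
  [/\ 0 < s <= 1, s ^+ 2 = t ^+ 2 * (1 - s), t <= 2 * s & t^-1 + 1 / 2 <= s^-1].
Proof.
move=> /andP[t0 t1]; set q := Num.sqrt _ => s.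
have t2 : 0 < t ^+ 2 by rewrite exprn_gt0.
have q2 : q ^+ 2 = t ^+ 2 + 4 by rewrite sqr_sqrtr//; lra.
have q0 : 0 <= q by rewrite sqrtr_ge0.
have qt : t + 1 <= q.
  rewrite -(@ler_pXn2r _ 2)// ?nnegrE; last lra.
  by rewrite q2 sqrrD; lra.
have ts : t <= 2 * s.
  by rewrite /s mulrA [2 * _]mulrC divfK// ler_peMr; lra.
have s0 : 0 < s by lra.
have sE : s ^+ 2 = t ^+ 2 * (1 - s).
  transitivity (t ^+ 2 * (q ^+ 2 - 2 * q * t + t ^+ 2) / 4); first by rewrite /s; field.
  by rewrite q2 /s; field.
have s1 : s <= 1.
  have := sqr_ge0 s; rewrite sE pmulr_rge0//; lra.
split=> //; first by rewrite s0.
have is0 : 1 <= s^-1 by rewrite -[1]invr1 lef_pV2 ?posrE.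
have it0 : 0 < t^-1 by rewrite invr_gt0.
have e : s^-1 ^+ 2 - s^-1 = t^-1 ^+ 2.
  transitivity ((1 - s) / s ^+ 2); first by field; rewrite gt_eqF.
  have s1' : 1 - s != 0.
    by apply/eqP => h; move: sE; rewrite h mulr0 => /eqP; rewrite sqrf_eq0 gt_eqF.
  by rewrite sE; field; rewrite s1' gt_eqF.
suff : t^-1 <= s^-1 - 1 / 2 by lra.
rewrite -(@ler_pXn2r _ 2)// ?nnegrE; [|lra|lra].
by rewrite sqrrB -e; lra.
Qed.

Lemma tau_bound (R : realType) (tau : nat -> R) : tau 0%N = 1 ->
  (forall k, tau k.+1 = tau k / 2 * (Num.sqrt (tau k ^+ 2 + 4) - tau k)) ->
  forall k, 0 < tau k <= 1 /\ tau k <= 2 / k.+2%:R.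
Proof.
move=> t0 tS k.
have [tk ik] : 0 < tau k <= 1 /\ k.+2%:R / 2 <= (tau k)^-1.
  elim: k => [|k [IH IH2]]; first by rewrite t0 ltr01 lexx invr1 divff.
  have [] := tau_recurrence IH; rewrite -tS => h _ _ h2; split=> //.
  by apply: le_trans h2; rewrite -natr1; lra.
split=> //; have /andP[tp _] := tk.
by rewrite -[leLHS]invrK -[leRHS]invrK lef_pV2 ?posrE ?invr_gt0 ?divr_gt0// invf_div.
Qed.

(** The bound on [a] is a little stronger than [a (2 c + 1) <= mu c^2], the
inequality at [j = 0]; for larger [j] the requirement is weaker. *)
Lemma polynomial_growth (R : realType) (a mu c j : R) :
  0 <= a -> 2 < c -> 0 <= j -> a <= c * (c - 1) * mu / (2 * c - 1) ->
  a / (c / (j + 1 + c)) ^+ 2 <= a / (c / (j + c)) ^+ 2 + mu / (c / (j + c)).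
Proof.
move=> a0 c2 j0 ha.
have c0 : 0 < c by lra.
have jc : 0 < j + c by lra.
have jc1 : 0 < j + 1 + c by lra.
have h : a * (2 * c + 1) <= mu * c ^+ 2.
  have d0 : 0 < 2 * c - 1 by lra.
  have mu0 : 0 <= mu.
    move: ha; rewrite ler_pdivlMr// => ha.
    have : 0 <= c * (c - 1) * mu by apply: le_trans ha; rewrite mulr_ge0//; lra.
    by rewrite pmulr_rge0// mulr_gt0//; lra.
  rewrite -(ler_pM2r d0).
  move: ha; rewrite ler_pdivlMr// => ha.
  have e1 : 0 <= 2 * c + 1 by lra.
  have := ler_wpM2r e1 ha.
  have : 0 <= mu * c by rewrite mulr_ge0// ltW.
  lra.
rewrite -subr_ge0.
have -> : a / (c / (j + c)) ^+ 2 + mu / (c / (j + c)) - a / (c / (j + 1 + c)) ^+ 2 =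
  (mu * c * (j + c) - a * (2 * (j + c) + 1)) / c ^+ 2.
  by field; rewrite !gt_eqF.
apply: divr_ge0; last by rewrite sqr_ge0.
rewrite subr_ge0 -(ler_pM2r c0).
have := ler_wpM2r (ltW jc) h.
have := mulr_ge0 a0 j0.
lra.
Qed.

(** Surplus left at step [j + 1] by the coefficients of the Lagrangian gap and of
the squared residual.  The first is explicit,
[((c - 2) (j + 1) + (c - 1)^2) / c^2]; the second is a difference of squares whose
other factor is at least [(j + 1)^2 / c^2]. *)
Lemma polynomial_drop (R : realType) (c : R) (j : nat) : 2 < c ->
  let t := c / (j%:R + c) in let t' := c / (j.+1%:R + c) in
  let al := (c - 2) / c ^+ 2 in
  al * j.+1%:R <= 1 / t ^+ 2 - (1 - t') / t' ^+ 2 /\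
  al / c ^+ 2 * j.+1%:R ^+ 3 <= (1 / t ^+ 2) ^+ 2 - ((1 - t') / t' ^+ 2) ^+ 2.
Proof.
move=> c2 t t' al.
have j0 : (0 : R) <= j%:R by [].
have c0 : 0 < c by lra.
have jc : 0 < j%:R + c by lra.
have jc1 : 0 < j.+1%:R + c by rewrite -natr1; lra.
have tE : 1 / t ^+ 2 = (j%:R + c) ^+ 2 / c ^+ 2 by rewrite /t; field; rewrite !gt_eqF.
have t'E : (1 - t') / t' ^+ 2 = j.+1%:R * (j.+1%:R + c) / c ^+ 2.
  by rewrite /t'; move: (j.+1%:R) jc1 => J jc1; field; rewrite !gt_eqF.
have c20 : 0 < c ^+ 2 by rewrite exprn_gt0.
have al0 : 0 <= al by rewrite divr_ge0 ?ltW//; lra.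
have b0 : 0 <= (1 - t') / t' ^+ 2 by rewrite t'E divr_ge0 ?mulr_ge0 ?ltW.
have drop : al * j.+1%:R <= 1 / t ^+ 2 - (1 - t') / t' ^+ 2.
  rewrite tE t'E -mulrBl /al mulrAC ler_pM2r ?invr_gt0// -natr1.
  have := sqr_ge0 (c - 1); lra.
split=> //.
have -> : al / c ^+ 2 * j.+1%:R ^+ 3 = (al * j.+1%:R) * (j.+1%:R ^+ 2 / c ^+ 2).
  by ring.
rewrite subr_sqr; apply: ler_pM => //.
- by rewrite mulr_ge0.
- by rewrite divr_ge0 ?sqr_ge0.
apply: le_trans (_ : _ <= 1 / t ^+ 2) _; last by rewrite lerDl.
rewrite tE ler_pM2r ?invr_gt0// lerXn2r ?nnegrE -?natr1//; lra.
Qed.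

(** * Consequences of the saddle-point property *)

Section Saddle.
Variables (R : realType) (p q n : nat).
Variables (f : 'cV[R]_p -> \bar R) (psi : 'cV[R]_q -> \bar R).
Variables (K : 'M[R]_(n, p)) (B : 'M[R]_(n, q)) (b : 'cV[R]_n).
Variables (xs : 'cV[R]_p) (ws : 'cV[R]_q) (ys : 'cV[R]_n).
Hypotheses (fp : proper f) (pp : proper psi).
Hypothesis sad : is_saddle_point f psi K B b xs ws ys.

Lemma saddle_dom : dom f xs /\ dom psi ws.
Proof.
have [fN [x0 dx0]] := fp; have [pN [w0 dw0]] := pp.
have [_] := sad x0 w0 ys; rewrite /lagrangian (domE fp dx0) (domE pp dw0).
have := fN xs; have := pN ws; rewrite /dom/=.
by case: (f xs) (psi ws) => [a| |] [c| |]//=; rewrite !ltry.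
Qed.

Lemma saddle_feasible : K *m xs + B *m ws = b.
Proof.
have [dx dw] := saddle_dom.
have [+ _] := sad xs ws (ys + residual K B b xs ws).
rewrite /lagrangian (domE fp dx) (domE pp dw) -!EFinD lee_fin dotvDl => h.
apply: subr0_eq; apply: dotv_eq0; apply/eqP; rewrite eq_le dotv_ge0 andbT.
by move: h; rewrite /residual; lra.
Qed.

Lemma lagrangian_gap_ge0 x w : dom f x -> dom psi w ->
  0 <= fine (f x) + fine (psi w) - (fine (f xs) + fine (psi ws))
       + dotv ys (residual K B b x w).
Proof.
have [dx dw] := saddle_dom => dx' dw'.
have [_] := sad x w ys.
rewrite /lagrangian (domE fp dx) (domE pp dw) (domE fp dx') (domE pp dw') -!EFinD lee_fin.
rewrite {1}/residual saddle_feasible subrr (_ : dotv ys 0 = 0); first lra.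
by rewrite -(scale0r 0) dotvZr mul0r.
Qed.

Lemma optimal_value_saddle :
  optimal_value f psi K B b = (fine (f xs) + fine (psi ws))%:E.
Proof.
have [dx dw] := saddle_dom.
apply/eqP; rewrite eq_le; apply/andP; split.
  apply: ereal_inf_lbound; exists xs, ws; split; first exact: saddle_feasible.
  by rewrite /objective (domE fp dx) (domE pp dw).
apply: le_ereal_inf_tmp => _ [x [w [xw ->]]].
have [_] := sad x w ys.
rewrite /lagrangian /residual xw saddle_feasible subrr (_ : dotv ys 0 = 0).
  by rewrite !adde0 (domE fp dx) (domE pp dw).
by rewrite -(scale0r 0) dotvZr mul0r.
Qed.

Lemma gap_fine x w : dom f x -> dom psi w ->
  `|objective f psi x w - optimal_value f psi K B b|%E =
  `|fine (f x) + fine (psi w) - (fine (f xs) + fine (psi ws))|%:E.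
Proof.
by move=> dx dw; rewrite /objective optimal_value_saddle (domE fp dx) (domE pp dw).
Qed.

End Saddle.

(** * The energy inequality *)

Section Energy.
Variables (R : realType) (p q n : nat).
Variables (f : 'cV[R]_p -> \bar R) (psi : 'cV[R]_q -> \bar R).
Variables (K : 'M[R]_(n, p)) (B : 'M[R]_(n, q)) (b : 'cV[R]_n) (mu : R).
Variables (xs : 'cV[R]_p) (ws : 'cV[R]_q).
Variables (gamma nu rho0 : R) (tau : nat -> R).
Variables (x xt xh : nat -> 'cV[R]_p) (w wh : nat -> 'cV[R]_q).
Variables (y yt yb : nat -> 'cV[R]_n).

Definition lag_gap (v : 'cV[R]_n) k : R :=
  fine (f (x k)) + fine (psi (w k)) - (fine (f xs) + fine (psi ws))
  + dotv v (residual K B b (x k) (w k)).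

(** The scheme has no sequence w-tilde; this one is determined by
[wh k = (1 - tau k) w k + tau k w_tilde k], which lets the extrapolation in [w]
be treated like the one in [x]. *)
Definition w_tilde k : 'cV[R]_q :=
  if k is j.+1 then (tau j)^-1 *: (w j.+1 - (1 - tau j) *: w j) else w 0.

Definition dist_energy (v : 'cV[R]_n) k : R :=
  rho0 * opnorm K ^+ 2 / Gam gamma / tau k ^+ 2 / 2 * dotv (xt k - xs) (xt k - xs)
  + nu / 2 * dotv (w_tilde k - ws) (w_tilde k - ws)
  + 1 / (2 * ((1 - gamma) * rho0)) * dotv (yt k - v) (yt k - v).

Let sqres k := dotv (residual K B b (x k) (w k)) (residual K B b (x k) (w k)).

Hypotheses (fp : proper f) (mu0 : 0 <= mu) (fs : strongly_convex mu f).
Hypotheses (pp : proper psi) (pc : econvex psi).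
Hypotheses (nu0 : 0 <= nu) (rho00 : 0 < rho0) (K0 : 0 < opnorm K).
Hypothesis gammaP : 1 / 2 < gamma < 1.
Hypotheses (dxs : dom f xs) (dws : dom psi ws) (feas : K *m xs + B *m ws = b).
Hypotheses (tau0 : tau 0%N = 1) (tau01 : forall k, 0 < tau k <= 1).
Hypothesis tau_growth : forall k,
  rho0 * opnorm K ^+ 2 / Gam gamma / tau k.+1 ^+ 2 <=
  rho0 * opnorm K ^+ 2 / Gam gamma / tau k ^+ 2 + mu / tau k.
Hypothesis sch : scheme f psi K B b gamma nu rho0 tau x xt xh w wh y yt yb.

Lemma Gam_gt0 : 0 < Gam gamma.
Proof.
have /andP[g0 g1] := gammaP.
have gpos : 0 < gamma by lra.
by rewrite /Gam subr_gt0 ltr_pdivrMr// mulrC -ltr_pdivrMr.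
Qed.

Lemma dist_energy_ge0 v k : 0 <= dist_energy v k.
Proof.
have /andP[g0 g1] := gammaP.
have rg : 0 < (1 - gamma) * rho0 by rewrite mulr_gt0//; lra.
have rL : 0 <= rho0 * opnorm K ^+ 2 by rewrite mulr_ge0 ?sqr_ge0 ?ltW.
rewrite /dist_energy; apply: addr_ge0; [apply: addr_ge0|];
  apply: mulr_ge0; rewrite ?dotv_ge0 //.
- by rewrite !divr_ge0 ?sqr_ge0 ?(ltW Gam_gt0).
- by rewrite divr_ge0.
- by rewrite divr_ge0 // mulr_ge0 // ltW.
Qed.

(** Holds for every multiplier [v], as the dual variable only enters through the
distance of [yt] to [v].  At [k = 0] the factor [1 - tau 0 = 0] removes the values
at the starting point, which may be infinite. *)
Lemma energy_step v k :
  [/\ dom f (x k.+1), dom psi (w k.+1) &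
    (lag_gap v k.+1 + rho0 / 2 / tau k ^+ 2 * sqres k.+1) / tau k ^+ 2
      + dist_energy v k.+1
    <= (1 - tau k) / tau k ^+ 2 *
         (lag_gap v k + rho0 / 2 * ((1 - tau k) / tau k ^+ 2) * sqres k)
       + dist_energy v k].
Proof.
have [xh0 xt0 wh0 _ _ Hw Hy Hxt Hx Hxh Hwh Hyt _] := sch.
have tpos j : 0 < tau j by have /andP[] := tau01 j.
have t2 j : 0 < tau j ^+ 2 by rewrite exprn_gt0.
have rk : 0 < rho_ rho0 tau k by rewrite divr_gt0.
have xhE j : xh j = (1 - tau j) *: x j + tau j *: xt j.
  by case: j => [|j]; rewrite ?Hxh// xh0 xt0 -scalerDl subrK scale1r.
have whE j : wh j = (1 - tau j) *: w j + tau j *: w_tilde j.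
  case: j => [|j]; first by rewrite wh0 -scalerDl subrK scale1r.
  rewrite Hwh /w_tilde; apply/matrixP => i l; rewrite !mxE.
  by field; rewrite gt_eqF.
have w'E j : w j.+1 = (1 - tau j) *: w j + tau j *: w_tilde j.+1.
  by rewrite /= scalerA mulfV ?gt_eqF// scale1r addrC subrK.
have taul j := tau01 j.
pose st v j (h : tau j = 1 \/ dom f (x j) /\ dom psi (w j)) :=
  admm_step v fp mu0 fs pp pc nu0 (divr_gt0 rho00 (t2 j)) K0 gammaP (taul j)
    dxs dws feas h (xhE j) (whE j) (w'E j) (Hw j) (Hy j) (Hxt j) (Hx j) (Hyt j).
have doms j : tau j = 1 \/ dom f (x j) /\ dom psi (w j).
  elim: j => [|j IH]; first by left.
  by right; have [] := st 0 j IH.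
have [dx dw] := st v k (doms k).
rewrite -/(lag_gap v k) -/(lag_gap v k.+1) => main.
split=> //.
have grow := tau_growth k.
have /andP[g0 g1] := gammaP.
have gn0 : 1 - gamma != 0 by rewrite gt_eqF//; lra.
have tn0 : tau k != 0 by rewrite gt_eqF.
have rn0 : rho0 != 0 by rewrite gt_eqF.
have Gn0 : Gam gamma != 0 by rewrite gt_eqF ?Gam_gt0.
have it2 : 0 <= (tau k ^+ 2)^-1 by rewrite invr_ge0 ltW.
have {main} := ler_wpM2r it2 main.
rewrite /sqres /dist_energy /rho_ /=.
move: (dotv (residual _ _ _ _ _) _) (dotv (residual _ _ _ _ _) _) => n0 n1.
set S1 := dotv (xt k.+1 - xs) _; set S0 := dotv (xt k - xs) _.
set Y1 := dotv (yt k.+1 - v) _; set Y0 := dotv (yt k - v) _.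
set W1 := dotv (_ - ws) _; set W0 := dotv (w_tilde k - ws) _.
have S1p : 0 <= S1 by apply: dotv_ge0.
have {grow} := ler_wpM2r S1p grow.
move: (rho0 * opnorm K ^+ 2 / Gam gamma / tau k.+1 ^+ 2) => A' grow.
move: (tau k) (lag_gap v k) (lag_gap v k.+1) tn0 grow => t d0 d1 tn0 grow main.
pose A := rho0 * opnorm K ^+ 2 / Gam gamma / t ^+ 2.
apply: le_trans (_ : _ <= (d1 + rho0 / 2 / t ^+ 2 * n1) / t ^+ 2
   + ((A + mu / t) * S1) / 2 + nu / 2 * W1 + 1 / (2 * ((1 - gamma) * rho0)) * Y1) _.
  by rewrite /A; lra.
apply: (le_trans (le_trans _ main)); rewrite le_eqVlt; apply/orP; left; apply/eqP.
  by rewrite /A; field; rewrite gn0 tn0 rn0 Gn0.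
by field; rewrite gn0 tn0 rn0 Gn0.
Qed.

End Energy.

(** * Convergence rates *)

(** The lower bound on [F] costs only [ny] of the penalty weight [2 ny + 1], which
leaves [ny + 1] for [r] alone. *)
Lemma bounds_of_penalty (R : realType) (F r ny M : R) :
  0 <= ny -> 0 <= r -> - (ny * r) <= F -> F + (2 * ny + 1) * r <= M ->
  `|F| <= M /\ r <= M.
Proof.
move=> ny0 r0 lo up; have nr : 0 <= ny * r by rewrite mulr_ge0.
by split; [rewrite ler_norml; apply/andP; split|]; lra.
Qed.

Section Rates.
Variables (R : realType) (p q n : nat).
Variables (f : 'cV[R]_p -> \bar R) (psi : 'cV[R]_q -> \bar R).
Variables (K : 'M[R]_(n, p)) (B : 'M[R]_(n, q)) (b : 'cV[R]_n) (mu : R).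
Variables (xs : 'cV[R]_p) (ws : 'cV[R]_q) (ys : 'cV[R]_n).
Variables (gamma nu rho0 : R) (tau : nat -> R).
Variables (x xt xh : nat -> 'cV[R]_p) (w wh : nat -> 'cV[R]_q).
Variables (y yt yb : nat -> 'cV[R]_n).
Hypotheses (fp : proper f) (mu0 : 0 < mu) (fs : strongly_convex mu f).
Hypotheses (pp : proper psi) (pc : econvex psi).
Hypothesis sad : is_saddle_point f psi K B b xs ws ys.
Hypothesis gammaP : 1 / 2 < gamma < 1.
Hypotheses (nu0 : 0 <= nu) (rho00 : 0 < rho0) (K0 : 0 < opnorm K).
Hypothesis sch : scheme f psi K B b gamma nu rho0 tau x xt xh w wh y yt yb.

Let lag v k := lag_gap f psi K B b xs ws x w v k.
Let dist v k := dist_energy K xs ws gamma nu rho0 tau xt w yt v k.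
Let infeas k := enorm (residual K B b (x k) (w k)).
Let gap k := `|objective f psi (x k) (w k) - optimal_value f psi K B b|%E.
Let delta k := fine (f (x k)) + fine (psi (w k)) - (fine (f xs) + fine (psi ws)).

(** Twice the weight of the squared distance to [xs] at [tau k = 1]. *)
Let a := rho0 * opnorm K ^+ 2 / Gam gamma.

Lemma weight_le (r s : R) : 0 < s ->
  rho0 <= r * Gam gamma * mu / (s * opnorm K ^+ 2) ->
  a <= r * mu / s.
Proof.
move=> s0; have L0 : 0 < opnorm K ^+ 2 by rewrite exprn_gt0.
rewrite ler_pdivlMr ?mulr_gt0// => h.
rewrite ler_pdivlMr// /a mulrAC ler_pdivrMr ?(Gam_gt0 gammaP)//; lra.
Qed.

(** [(1 - tau 0) = 0] and the identity [tau_eq] make the energy inequality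
telescope to [dist v 0] whatever the sign of the Lagrangian gap; the
multiplier may therefore be adapted to the residual at the last iterate. *)
Lemma fast_rate : rho0 <= Gam gamma * mu / (2 * opnorm K ^+ 2) ->
  tau 0%N = 1 ->
  (forall k, tau k.+1 = tau k / 2 * (Num.sqrt (tau k ^+ 2 + 4) - tau k)) ->
  let R0sq := rho0 * opnorm K ^+ 2 / Gam gamma * enorm (x 0%N - xs) ^+ 2
              + nu * enorm (w 0%N - ws) ^+ 2
              + 1 / (rho0 * (1 - gamma))
                * (2 * enorm ys + enorm (y 0%N) + 1) ^+ 2 in
  forall k, (1 <= k)%N ->
    (gap k <= (2 * R0sq / k.+1%:R ^+ 2)%:E)%E /\
    infeas k <= 2 * R0sq / k.+1%:R ^+ 2.
Proof.
move=> rho_le tau0 tauS R0sq [//|k] _.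
have aP : 2 * a <= mu.
  have := @weight_le 1 2 (ltr0Sn R 1); rewrite !mul1r => /(_ rho_le); lra.
have a0 : 0 <= a by rewrite /a divr_ge0 ?mulr_ge0 ?sqr_ge0 ?ltW// (Gam_gt0 gammaP).
have tau01 j : 0 < tau j <= 1 by have [] := tau_bound tau0 tauS j.
have tpos j : 0 < tau j by have /andP[] := tau01 j.
have tau_eq j : (1 - tau j.+1) / tau j.+1 ^+ 2 = 1 / tau j ^+ 2.
  have [_ e _ _] := tau_recurrence (tau01 j); rewrite -tauS in e.
  have tj : 1 - tau j.+1 != 0.
    apply/eqP => h; move/eqP: e; rewrite h mulr0 sqrf_eq0.
    by rewrite gt_eqF.
  by rewrite e; field; rewrite tj gt_eqF.
have growth j : a / tau j.+1 ^+ 2 <= a / tau j ^+ 2 + mu / tau j.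
  have [_ _ le2 _] := tau_recurrence (tau01 j); rewrite -tauS in le2.
  have -> : a / tau j ^+ 2 = a * ((1 - tau j.+1) / tau j.+1 ^+ 2).
    by rewrite tau_eq div1r.
  have -> : a * ((1 - tau j.+1) / tau j.+1 ^+ 2) = a / tau j.+1 ^+ 2 - a / tau j.+1.
    by field; rewrite gt_eqF.
  suff : a / tau j.+1 <= mu / tau j by lra.
  rewrite ler_pdivrMr// mulrAC ler_pdivlMr//.
  have := ler_wpM2l a0 le2; have := ler_wpM2r (ltW (tpos j.+1)) aP; lra.
have [dxs dws] := saddle_dom fp pp sad.
have feas := saddle_feasible fp pp sad.
pose st := energy_step fp (ltW mu0) fs pp pc nu0 rho00 K0 gammaP dxs dws feas
  tau0 tau01 growth sch.
have tele v j : (lag v j.+1 + rho0 / 2 / tau j ^+ 2 * infeas j.+1 ^+ 2) / tau j ^+ 2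
    + dist v j.+1 <= dist v 0.
  rewrite enorm_sqr; elim: j => [|j IH].
    by have [_ _] := st v 0%N; rewrite (_ : 1 - tau 0 = 0) ?tau0 ?subrr// !mul0r add0r.
  have [_ _ h] := st v j.+1; apply: le_trans h _; apply: le_trans IH.
  by rewrite tau_eq div1r mulrC.
have [dx dw _] := st ys k.
rewrite /gap (gap_fine fp pp sad dx dw) lee_fin.
have lo := lagrangian_gap_ge0 fp pp sad dx dw.
set r := residual K B b (x k.+1) (w k.+1) in lo.
apply: (@bounds_of_penalty _ _ _ (enorm ys)); rewrite ?enorm_ge0//.
  by have := dotv_le ys r; rewrite -/r /infeas -/r; lra.
have ny0 := enorm_ge0 ys.
have c0 : 0 <= 2 * enorm ys + 1 by lra.
have [v vr vn] := exists_aligned r c0.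
have dpos j : 0 <= dist v j by exact: dist_energy_ge0.
have main := tele v k; have dk := dpos k.+1.
have t2 : 0 < tau k ^+ 2 by rewrite exprn_gt0.
have pen : lag v k.+1 <= tau k ^+ 2 * dist v 0.
  rewrite mulrC -ler_pdivrMr//; apply: le_trans main.
  apply: le_trans (_ : _ <= (lag v k.+1 + rho0 / 2 / tau k ^+ 2 * infeas k.+1 ^+ 2) / tau k ^+ 2) _.
    by rewrite ler_pM2r ?invr_gt0// lerDl mulr_ge0 ?sqr_ge0 ?divr_ge0 ?ltW.
  by rewrite lerDl.
have g1 : 0 < 1 - gamma by have /andP[_] := gammaP; lra.
have dist0 : dist v 0 <= R0sq / 2.
  rewrite /dist /dist_energy (scheme_xt0 sch) (scheme_yt0 sch) /= tau0 expr1n divr1.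
  have nyv : enorm (y 0%N - v) <= 2 * enorm ys + enorm (y 0%N) + 1.
    by apply: le_trans (enormD _ _) _; rewrite enormN; lra.
  have {}nyv : dotv (y 0%N - v) (y 0%N - v) <= (2 * enorm ys + enorm (y 0%N) + 1) ^+ 2.
    have y0 := enorm_ge0 (y 0%N).
    by rewrite -enorm_sqr lerXn2r ?nnegrE ?enorm_ge0//; lra.
  have c1 : 0 <= 1 / (2 * ((1 - gamma) * rho0)).
    by rewrite divr_ge0// mulr_ge0// mulr_ge0// ltW.
  have := ler_wpM2l c1 nyv; rewrite /R0sq !enorm_sqr.
  have -> : 1 / (rho0 * (1 - gamma)) = 2 * (1 / (2 * ((1 - gamma) * rho0))).
    by field; rewrite !gt_eqF.
  move: (1 / (2 * _)) => C; lra.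
have [_ tb] := tau_bound tau0 tauS k.
have tb2 : tau k ^+ 2 <= 4 / k.+2%:R ^+ 2.
  have -> : 4 / k.+2%:R ^+ 2 = (2 / k.+2%:R : R) ^+ 2.
    by rewrite expr_div_n; congr (_ / _); rewrite -natrX.
  by rewrite lerXn2r ?nnegrE ?divr_ge0// ltW.
have q0 : 0 <= 4 / (k.+2%:R : R) ^+ 2 by rewrite divr_ge0 ?sqr_ge0.
have := ler_wpM2r (dpos 0%N) tb2; have := ler_wpM2l q0 dist0.
have -> : 2 * R0sq / k.+2%:R ^+ 2 = 4 / k.+2%:R ^+ 2 * (R0sq / 2).
  by move: (k.+2%:R ^+ 2)^-1 => Q; field.
move: pen; rewrite /lag /lag_gap -/r vr /infeas -/r; clearbody R0sq.
by move=> h1 h2 h3; exact: le_trans h1 (le_trans h3 h2).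
Qed.

(** The energy [W]: at [k.+1] it is the left-hand side of [energy_step] for
[v = ys], and at 0 the initial distance, so that it does not increase at the
first step either. *)
Lemma polynomial_energy c : 2 < c ->
  rho0 <= c * (c - 1) * Gam gamma * mu / ((2 * c - 1) * opnorm K ^+ 2) ->
  (forall k : nat, tau k = c / (k%:R + c)) ->
  exists W : nat -> R, exists2 d, 0 < d &
    [/\ forall k, 0 <= W k,
        forall k, [/\ dom f (x k.+1), dom psi (w k.+1) &
          (lag ys k.+1 + rho0 / 2 / tau k ^+ 2 * infeas k.+1 ^+ 2) / tau k ^+ 2
            <= W 0%N] &
        forall k, (1 <= k)%N ->
          W k.+1 + d * (k%:R * lag ys k + k%:R ^+ 3 * infeas k ^+ 2) <= W k].
Proof.
move=> c2 rho_le tauE.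
have c0 : 0 < c by lra.
have tau0 : tau 0%N = 1 by rewrite tauE add0r divff// gt_eqF.
have kc (k : nat) : 0 < k%:R + c by rewrite ltr_wpDl.
have tau01 j : 0 < tau j <= 1.
  by rewrite tauE divr_gt0//= ler_pdivrMr// mul1r lerDr.
have tpos j : 0 < tau j by have /andP[] := tau01 j.
have a0 : 0 <= a by rewrite /a divr_ge0 ?mulr_ge0 ?sqr_ge0 ?ltW// (Gam_gt0 gammaP).
have c21 : 0 < 2 * c - 1 by lra.
have growth j : a / tau j.+1 ^+ 2 <= a / tau j ^+ 2 + mu / tau j.
  rewrite !tauE -natr1; apply: polynomial_growth => //; exact: weight_le.
have [dxs dws] := saddle_dom fp pp sad.
have feas := saddle_feasible fp pp sad.
pose st := energy_step fp (ltW mu0) fs pp pc nu0 rho00 K0 gammaP dxs dws feas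
  tau0 tau01 growth sch ys.
pose E k := (lag ys k.+1 + rho0 / 2 / tau k ^+ 2 * infeas k.+1 ^+ 2) / tau k ^+ 2.
pose W k := if k is j.+1 then E j + dist ys k else dist ys 0.
have doms k : dom f (x k.+1) /\ dom psi (w k.+1) by have [] := st k.
have lag0 k : 0 <= lag ys k.+1.
  have [dx dw] := doms k; exact (lagrangian_gap_ge0 fp pp sad dx dw).
have dpos j : 0 <= dist ys j by exact: dist_energy_ge0.
have E0 k : 0 <= E k.
  apply: divr_ge0; last exact: sqr_ge0.
  by apply: addr_ge0 => //; rewrite mulr_ge0 ?sqr_ge0// !divr_ge0 ?sqr_ge0// ltW.
have W0 k : 0 <= W k by case: k => [|k] //=; rewrite addr_ge0.
pose al := (c - 2) / c ^+ 2.
have al0 : 0 < al by rewrite divr_gt0 ?exprn_gt0//; lra.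
pose d := Num.min al (rho0 / 2 * (al / c ^+ 2)).
have d0 : 0 < d.
  by rewrite lt_min al0 mulr_gt0// divr_gt0// exprn_gt0.
have step j : W j.+2 + d * (j.+1%:R * lag ys j.+1 + j.+1%:R ^+ 3 * infeas j.+1 ^+ 2) <= W j.+1.
  have [_ _] := st j.+1; rewrite -!enorm_sqr -/(lag ys j.+1) -/(lag ys j.+2).
  rewrite -/(dist ys j.+1) -/(dist ys j.+2) -/(infeas j.+1) -/(infeas j.+2) -/(E j.+1).
  rewrite /W /E => main.
  have [drop1 drop2] := polynomial_drop j c2; rewrite -!tauE in drop1 drop2.
  move: drop1 drop2 main; rewrite -/al div1r.
  move: (_ / tau j.+1 ^+ 2) ((tau j ^+ 2)^-1) (lag ys j.+1) (lag0 j) => T S D D0.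
  have := sqr_ge0 (infeas j.+1); move: (infeas j.+1 ^+ 2) => N N0 drop1 drop2 main.
  have J0 : (0 : R) <= j.+1%:R by [].
  have J30 : (0 : R) <= j.+1%:R ^+ 3 by rewrite exprn_ge0.
  have hD : d * (j.+1%:R * D) <= (S - T) * D.
    rewrite mulrA ler_wpM2r//; apply: le_trans drop1.
    by rewrite ler_wpM2r// ge_min lexx.
  have hN : d * (j.+1%:R ^+ 3 * N) <= rho0 / 2 * (S ^+ 2 - T ^+ 2) * N.
    rewrite mulrA ler_wpM2r//.
    apply: le_trans (ler_wpM2l _ drop2); last by rewrite divr_ge0// ltW.
    by rewrite [leRHS]mulrA ler_wpM2r// ge_min lexx orbT.
  rewrite mulrDr; lra.
exists W, d => //; split=> [//|k|[//|k] _]; last exact: step.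
have [dx dw] := doms k; split=> //.
rewrite -/(E k); apply: le_trans (_ : _ <= W k.+1) _; first by rewrite /= lerDl.
elim: k {dx dw} => [|k IH].
  have [_ _] := st 0%N; rewrite (_ : 1 - tau 0 = 0) ?tau0 ?subrr// !mul0r add0r.
  by rewrite /= /E /infeas enorm_sqr tau0.
apply: le_trans IH; apply: le_trans (step k); rewrite lerDl.
apply: mulr_ge0; first exact: ltW.
by rewrite addr_ge0// mulr_ge0// ?exprn_ge0// enorm_ge0.
Qed.

(** From the bounded energy to the four claims: [|F - F*| <= G + |ys| |r|]
transfers the bounds on [G] and [r] to the objective. *)
Lemma polynomial_rate c : 2 < c ->
  rho0 <= c * (c - 1) * Gam gamma * mu / ((2 * c - 1) * opnorm K ^+ 2) ->
  (forall k : nat, tau k = c / (k%:R + c)) ->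
  [/\ \forall k \near \oo, gap k \is a fin_num,
      (fun k => fine (gap k)) =O_\oo (fun k => 1 / k%:R ^+ 2 : R),
      infeas =O_\oo (fun k => 1 / k%:R ^+ 2 : R)
    & limn_einf (fun k =>
        (k%:R ^+ 2 * Num.sqrt (ln (k%:R : R)))%:E
        * (gap k + (infeas k)%:E))%E = 0%E].
Proof.
move=> c2 rho_le tauE.
have [W [d d0 [W0 bnd step]]] := polynomial_energy c2 rho_le tauE.
have doms k : dom f (x k.+1) /\ dom psi (w k.+1) by have [] := bnd k.
have lag0 k : 0 <= lag ys k.+1.
  have [dx dw] := doms k; exact (lagrangian_gap_ge0 fp pp sad dx dw).
have gapE k : gap k.+1 = `|delta k.+1|%:E.
  have [dx dw] := doms k; exact (gap_fine fp pp sad dx dw).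
have inf0 k : 0 <= infeas k by exact: enorm_ge0.
have ny0 := enorm_ge0 ys.
have gap_le k : `|delta k.+1| <= lag ys k.+1 + enorm ys * infeas k.+1.
  have h := dotv_norm ys (residual K B b (x k.+1) (w k.+1)).
  apply: le_trans (lerD (lexx _) h).
  rewrite -[leRHS](ger0_norm (addr_ge0 (lag0 k) (normr_ge0 _))) -[lag _ _]ger0_norm//.
  have -> : delta k.+1 = lag ys k.+1 - dotv ys (residual K B b (x k.+1) (w k.+1)).
    by rewrite /lag /lag_gap addrK.
  apply: le_trans (ler_normB _ _) _.
  by rewrite [leRHS]ger0_norm// addr_ge0.
have c0 : 0 < c by lra.
have tauk k : 0 < tau k /\ tau k <= c / k.+1%:R.
  rewrite tauE; split; first by rewrite divr_gt0// ltr_wpDl.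
  by rewrite ler_pM2l// lef_pV2 ?posrE// ?ltr_wpDl// -natr1; lra.
have lagb k : lag ys k.+1 <= W 0%N * c ^+ 2 * (1 / k.+1%:R ^+ 2).
  have [_ _ h] := bnd k; have [tp tb] := tauk k.
  have t2 : 0 < tau k ^+ 2 by rewrite exprn_gt0.
  apply: le_trans (_ : _ <= W 0%N * tau k ^+ 2) _.
    rewrite -ler_pdivrMr//; apply: le_trans h.
    by rewrite ler_pM2r ?invr_gt0// lerDl mulr_ge0 ?sqr_ge0// !divr_ge0 ?sqr_ge0// ltW.
  rewrite -mulrA ler_wpM2l// mul1r -expr_div_n.
  by rewrite lerXn2r ?nnegrE ?divr_ge0// ltW.
pose C := Num.sqrt (2 * W 0%N / rho0) * c ^+ 2.
have C0 : 0 <= C by rewrite mulr_ge0 ?sqr_ge0 ?sqrtr_ge0.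
have infb k : infeas k.+1 <= C * (1 / k.+1%:R ^+ 2).
  have [_ _ h] := bnd k; have [tp tb] := tauk k.
  have t2 : 0 < tau k ^+ 2 by rewrite exprn_gt0.
  apply: le_trans (_ : _ <= Num.sqrt (2 * W 0%N / rho0) * tau k ^+ 2) _.
    have V0 : 0 <= 2 * W 0%N / rho0 by rewrite divr_ge0 ?(ltW rho00)// mulr_ge0.
    have sq : infeas k.+1 ^+ 2 <= 2 * W 0%N / rho0 * (tau k ^+ 2) ^+ 2.
      have {}h : rho0 / 2 / tau k ^+ 2 * infeas k.+1 ^+ 2 / tau k ^+ 2 <= W 0%N.
        by apply: le_trans h; rewrite ler_pM2r ?invr_gt0// lerDr.
      have w0 : 0 <= 2 / rho0 * (tau k ^+ 2) ^+ 2.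
        by rewrite mulr_ge0 ?sqr_ge0// divr_ge0// ltW.
      have := ler_wpM2l w0 h.
      rewrite (_ : _ * (_ / _) = infeas k.+1 ^+ 2); last by field; rewrite !gt_eqF.
      by move/le_trans; apply; rewrite le_eqVlt; apply/orP; left; apply/eqP; ring.
    rewrite -(@ler_pXn2r _ 2) ?nnegrE ?(mulr_ge0 (sqrtr_ge0 _) (ltW t2))//.
    by rewrite [leRHS]exprMn (sqr_sqrtr V0).
  rewrite /C -[leRHS]mulrA ler_wpM2l ?sqrtr_ge0// mul1r -expr_div_n.
  by rewrite lerXn2r ?nnegrE ?divr_ge0// ltW.
have bigO (g : nat -> R) (M : R) : (forall k, `|g k.+1| <= M * (1 / k.+1%:R ^+ 2)) ->
    g =O_\oo (fun k => 1 / k%:R ^+ 2 : R).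
  move=> gM; apply/eqO_exP; exists (`|M| + 1); first by rewrite ltr_wpDl.
  exists 1%N => // -[//|k] _ /=; apply: le_trans (gM k) _.
  rewrite [X in _ <= _ * X]ger0_norm ?divr_ge0 ?sqr_ge0//.
  by rewrite ler_wpM2r ?divr_ge0 ?sqr_ge0//; have := ler_norm M; lra.
split.
- by exists 1%N => // -[//|k] _ /=; rewrite gapE.
- apply: (bigO _ (W 0%N * c ^+ 2 + enorm ys * C)) => k.
  rewrite gapE /= normr_id; apply: le_trans (gap_le k) _.
  by rewrite mulrDl lerD// -mulrA ler_wpM2l.
- by apply: (bigO _ C) => k; rewrite ger0_norm.
apply: limn_einf_eq0 => [k|e e0 N].
  apply: mule_ge0; last by rewrite adde_ge0 ?abse_ge0 ?lee_fin.
  by rewrite lee_fin mulr_ge0 ?sqr_ge0 ?sqrtr_ge0.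
have lag_pos k : (1 <= k)%N -> 0 <= lag ys k by case: k.
have ny1 : 0 <= enorm ys + 1 by rewrite addr_ge0.
have [k Nk hk] := liminf_sqrt_log N.+1 d0 ny1 e0 lag_pos inf0 W0 step.
case: k Nk hk => // k Nk hk; exists k.+1; first exact: leq_trans (leqnSn N) Nk.
rewrite gapE -EFinD -EFinM lee_fin; apply: le_trans hk.
rewrite ler_wpM2l ?mulr_ge0 ?sqr_ge0 ?sqrtr_ge0//.
by rewrite mulrDl mul1r addrA lerD2r.
Qed.

End Rates.

Theorem corollary4p6 (R : realType) (p q n : nat)
    (f : 'cV[R]_p -> \bar R) (psi : 'cV[R]_q -> \bar R)
    (K : 'M[R]_(n, p)) (B : 'M[R]_(n, q)) (b : 'cV[R]_n) (mu_f : R)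
    (xs : 'cV[R]_p) (ws : 'cV[R]_q) (ys : 'cV[R]_n)
    (gamma nu0 rho0 : R) (tau : nat -> R)
    (x xt xh : nat -> 'cV[R]_p) (w wh : nat -> 'cV[R]_q)
    (y yt yb : nat -> 'cV[R]_n) :
  proper_closed_convex f ->
  proper_closed_convex psi ->
  (exists (x' : 'cV[R]_p) (w' : 'cV[R]_q), is_solution f psi K B b x' w') ->
  (exists (x' : 'cV[R]_p) (w' : 'cV[R]_q),
     [/\ relint (dom f) x', relint (dom psi) w' & K *m x' + B *m w' = b]) ->
  0 < mu_f ->
  strongly_convex mu_f f ->
  is_saddle_point f psi K B b xs ws ys ->
  1 / 2 < gamma < 1 ->
  0 <= nu0 ->
  0 < rho0 ->
  scheme f psi K B b gamma nu0 rho0 tau x xt xh w wh y yt yb ->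
  let gap := fun k : nat =>
    `|objective f psi (x k) (w k) - optimal_value f psi K B b|%E in
  let infeas := fun k : nat => enorm (residual K B b (x k) (w k)) in
  (0 < rho0 <= Gam gamma * mu_f / (2 * opnorm K ^+ 2) ->
   tau 0%N = 1 ->
   (forall k, tau k.+1 = tau k / 2 * (Num.sqrt (tau k ^+ 2 + 4) - tau k)) ->
   let R0sq := rho0 * opnorm K ^+ 2 / Gam gamma * enorm (x 0%N - xs) ^+ 2
               + nu0 * enorm (w 0%N - ws) ^+ 2
               + 1 / (rho0 * (1 - gamma))
                 * (2 * enorm ys + enorm (y 0%N) + 1) ^+ 2 in
   forall k, (1 <= k)%N ->
     (gap k <= (2 * R0sq / k.+1%:R ^+ 2)%:E)%E /\
     infeas k <= 2 * R0sq / k.+1%:R ^+ 2)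
  /\
  (forall c : R, 2 < c ->
   0 < rho0 <= c * (c - 1) * Gam gamma * mu_f
               / ((2 * c - 1) * opnorm K ^+ 2) ->
   (forall k : nat, tau k = c / (k%:R + c)) ->
   [/\ \forall k \near \oo, gap k \is a fin_num,
       (fun k => fine (gap k)) =O_\oo (fun k => 1 / k%:R ^+ 2 : R),
       infeas =O_\oo (fun k => 1 / k%:R ^+ 2 : R)
     & limn_einf (fun k =>
         (k%:R ^+ 2 * Num.sqrt (ln (k%:R : R)))%:E
         * (gap k + (infeas k)%:E))%E = 0%E]).

Proof.
move=> [fp _ _] [pp _ pc] _ _ mu0 fs sad gammaP nu_ge0 rho0_gt0 sch gap infeas.
have op_gt0 (r : R) : rho0 <= r / opnorm K ^+ 2 -> 0 < opnorm K.
  move=> h; rewrite lt_neqAle opnorm_ge0 andbT eq_sym; apply/eqP => K0.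
  by move: h; rewrite K0 expr0n invr0 mulr0 leNgt rho0_gt0.
split=> [/andP[_ rho_le] tau0 tauS|c c2 /andP[_ rho_le] tauE].
  apply: (fast_rate fp mu0 fs pp pc sad gammaP nu_ge0 rho0_gt0 _ sch) => //.
  by apply: (op_gt0 (Gam gamma * mu_f / 2)); rewrite -mulrA -invfM.
apply: (polynomial_rate fp mu0 fs pp pc sad gammaP nu_ge0 rho0_gt0 _ sch c2) => //.
apply: (op_gt0 (c * (c - 1) * Gam gamma * mu_f / (2 * c - 1))).
by rewrite -mulrA -invfM.
Qed.
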